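(* Let $\tau_3(n)$ denote the maximum number of rainbow triangles in an almost $3$-Gallai colouring of $E(K_n)$. Then \[ \left(\tfrac{1}{2} - o(1)\right) n \log n \le \tau_3(n) \le O\big(n^{\sqrt{2}} \log n\big). \] Moreover, the lower bound is attained by almost $3$-Gallai colourings of $E(K_n)$ that use only three colours.
   Context: A colouring $c : E(K_n) \to \mathbb{N}$ of the edges of $K_n$ is almost $3$-Gallai if no two rainbow triangles share an edge, where a triangle is rainbow if its three edges have pairwise distinct colours. All logarithms are in base $2$. *)

(* Defs.v *)
From Stdlib Require Import Reals.
From mathcomp Require Import all_boot.
From mathcomp Require Import boolp.

Set Implicit Arguments.
Unset Strict Implicit.
Unset Printing Implicit Defensive.

(* An edge colouring of K_n: a map from edges (2-element subsets of 'I_n)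
   to colours in nat.  Only its values on 2-sets matter. *)
Definition colouring (n : nat) := {set 'I_n} -> nat.

Definition rainbow (n : nat) (c : colouring n) (T : {set 'I_n}) : bool :=
  (#|T| == 3) &&
  [exists x : 'I_n, exists y : 'I_n, exists z : 'I_n,
     [&& T == [set x; y; z],
         c [set x; y] != c [set y; z],
         c [set y; z] != c [set x; z] &
         c [set x; y] != c [set x; z]]].

(* Almost 3-Gallai: no two (distinct) rainbow triangles share an edge,
   i.e. share two vertices. *)
Definition almost_gallai3 (n : nat) (c : colouring n) : Prop :=
  forall T1 T2 : {set 'I_n}, rainbow c T1 -> rainbow c T2 -> T1 != T2 ->
    #|T1 :&: T2| < 2.

Definition num_rainbow (n : nat) (c : colouring n) : nat :=
  #|[set T : {set 'I_n} | rainbow c T]|.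

Definition uses_three_colours (n : nat) (c : colouring n) : Prop :=
  exists a b d : nat, forall x y : 'I_n, x != y ->
    c [set x; y] \in [:: a; b; d].

(* tau_3(n): the maximum number of rainbow triangles in an almost 3-Gallai
   colouring of E(K_n).  The count is always <= #|{set 'I_n}| = 2^n, so the
   maximum over k < 2^n.+1 of the attained values is the true maximum. *)
Definition tau3 (n : nat) : nat :=
  \max_(k < (2 ^ n).+1 |
        `[< exists c : colouring n, almost_gallai3 c /\ num_rainbow c = k >])
    (k : nat).

Definition log2 (x : R) : R := Rdiv (ln x) (ln (INR 2)).

(* Main.v *)
(** Lower bound. Take the points of a subset of a d-dimensional cube and d extra
    vertices, one for each coordinate. Colour the edges of the cube green, and colour
    the edge from a point to a coordinate red or blue according to the value of that
    coordinate; all other edges are red. A rainbow triangle consists of a cube edge and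
    its direction, so distinct ones share no edge, and taking the initial segment of
    the integers as points gives almost (n log n) / 2 of them.

    Upper bound, in fact with an exponent smaller than sqrt 2. Merging colours at
    random we may assume that there are three. For a vertex v, an edge between two
    colour neighbourhoods of v has one of the two colours in question unless it forms
    a rainbow triangle with v; such exceptional edges form a matching and can be sampled
    away. Then the triangles with two vertices in one neighbourhood and one in another
    form an edge set of a hypercube, so there are O(n log n) of them, and the triangles
    with one vertex in each neighbourhood are edge-disjoint cyclic triangles of a
    tripartite tournament, so there are O(n) of them. If two neighbourhoods of some v
    are large, split along v and use induction. Otherwise almost all vertices have the
    same majority colour, say red; choose v with many triangles whose red edge is
    opposite to v, and delete a positive proportion of its blue or green neighbourhood,
    which destroys few triangles. *)

Require Import Defs.
From Stdlib Require Import Reals Lra.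
From mathcomp Require Import all_boot boolp zify.

Set Implicit Arguments.
Unset Strict Implicit.
Unset Printing Implicit Defensive.

(** * Random subsets by counting *)

(** Such an [H] is [A] together with an arbitrary set of points outside [A] and [B]. *)
Lemma card_sets_between (V : finType) (A B : {set V}) : [disjoint A & B] ->
  #|[set H : {set V} | (A \subset H) && [disjoint B & H]]| * 2 ^ (#|A| + #|B|)
    = 2 ^ #|V|.
Proof.
move=> dAB; set S := [set H | _].
have -> : S = [set A :|: Y | Y in powerset (~: (A :|: B))].
  apply/setP=> H; rewrite inE; apply/andP/imsetP => [[AH dBH] | [Y]].
    exists (H :\: A).
      rewrite powersetE; apply/subsetP=> x; rewrite !inE => /andP[nA xH].
      rewrite negb_or nA /=; apply/negP => xB.
      by move/disjointFr: dBH => /(_ _ xB); rewrite xH.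
    by apply/setP=> x; rewrite !inE; have := subsetP AH x; case: (x \in A) => //= ->.
  rewrite powersetE => /subsetP sY ->; split; first exact: subsetUl.
  apply/pred0P=> x /=; rewrite !inE; apply/negP=> /andP[xB /orP[xA | /sY]].
    by rewrite (disjointFr dAB xA) in xB.
  by rewrite !inE negb_or xB andbF.
rewrite card_in_imset => [|Y Z].
  rewrite card_powerset -expnD; congr (2 ^ _).
  have -> : #|A| + #|B| = #|A :|: B|.
    by rewrite cardsU disjoint_setI0 // cards0 subn0.
  by rewrite addnC cardsC.
rewrite !powersetE => /subsetP sY /subsetP sZ /setP eqYZ; apply/setP=> x.
have := eqYZ x; have := sY x; have := sZ x; rewrite !inE negb_or.
by case: (x \in A) => //=; case: (x \in Y); case: (x \in Z) => // _ /(_ isT).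
Qed.

(* A uniformly random [H] contains [A t] and avoids [B t] with probability at
   least [2 ^ -k]. *)
Lemma exists_popular_set (I V : finType) (F : {set I}) (A B : I -> {set V}) k :
  (forall t, t \in F -> [disjoint A t & B t]) ->
  (forall t, t \in F -> #|A t| + #|B t| <= k) ->
  exists H : {set V},
    #|F| <= 2 ^ k * #|[set t in F | (A t \subset H) && [disjoint B t & H]]|.
Proof.
move=> dAB cAB; pose ok t (H : {set V}) := (A t \subset H) && [disjoint B t & H].
have [H hH | noH] := pickP (fun H => #|F| <= 2 ^ k * #|[set t in F | ok t H]|).
  by exists H.
have lt H : 2 ^ k * #|[set t in F | ok t H]| < #|F|.
  by rewrite ltnNge noH.
(* Otherwise every [H] falls short of the average; but after exchanging the sums,
   [card_sets_between] gives each [t] its full share. *)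
have : \sum_(H : {set V}) 2 ^ k * #|[set t in F | ok t H]| < 2 ^ #|V| * #|F|.
  apply: (@leq_ltn_trans (\sum_(H : {set V}) #|F|.-1)).
    by apply: leq_sum => H _; have := lt H; lia.
  rewrite sum_nat_const.
  have -> : #|{: {set V}}| = 2 ^ #|V|.
    by have := card_powerset [set: V]; rewrite powersetT !cardsT.
  rewrite ltn_mul2l expn_gt0 /=; have := lt set0; lia.
rewrite -big_distrr /=.
have -> : \sum_(H : {set V}) #|[set t in F | ok t H]|
        = \sum_(t in F) #|[set H : {set V} | ok t H]|.
  transitivity (\sum_(H : {set V}) \sum_(t in F | ok t H) 1).
    by apply: eq_bigr => H _; rewrite sum1dep_card.
  rewrite (exchange_big_dep (mem F)) /=; last by move=> H t _ /andP[].
  by apply: eq_bigr => t tF; rewrite sum1dep_card; apply: eq_card => H; rewrite !inE tF.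
rewrite big_distrr /= ltnNge => /negP[].
rewrite mulnC -sum_nat_const; apply: leq_sum => t tF.
rewrite -(card_sets_between (dAB t tF)) mulnC.
by rewrite leq_mul2r leq_exp2l // cAB // orbT.
Qed.

(** * Edge sets cut by labels, as in a hypercube *)

(** Twice the smaller part is at most the sum, so the logarithm of the smaller part rises by at
    least one. The gain [a] pays for a matching across a cut with smaller side [a]. *)
Lemma mul_trunc_logD a b : a <= b ->
  a * trunc_log 2 a + b * trunc_log 2 b + a <= (a + b) * trunc_log 2 (a + b).
Proof.
move=> ab; case: a ab => [|a] ab; first by rewrite !mul0n !add0n addn0.
have h1 : (trunc_log 2 a.+1).+1 <= trunc_log 2 (a.+1 + b).
  rewrite -trunc_log2_double //; apply: leq_trunc_log; rewrite -addnn; lia.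
have h2 : trunc_log 2 b <= trunc_log 2 (a.+1 + b) by apply: leq_trunc_log; lia.
nia.
Qed.

Lemma leq_card_inj_in (T T' : finType) (f : T -> T') (A : {set T}) (B : {set T'}) :
  {in A &, injective f} -> (forall x, x \in A -> f x \in B) -> #|A| <= #|B|.
Proof.
move=> injf fAB; rewrite -(card_in_imset injf); apply: subset_leq_card.
by apply/subsetP=> _ /imsetP[x xA ->]; exact: fAB.
Qed.

Lemma leq_card_cover2 (T : finType) (A B C : {set T}) b c :
  A \subset B :|: C -> #|B| <= b -> #|C| <= c -> #|A| <= b + c.
Proof.
move=> /subset_leq_card le1 leB leC.
exact: leq_trans (leq_trans le1 (leq_card_setU _ _).1) (leq_add leB leC).
Qed.

Definition triples (V : finType) (E : V -> V -> V -> bool) (P P' Q : {set V}) :=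
  [set t : V * V * V | [&& t.1.1 \in P, t.1.2 \in P', t.2 \in Q & E t.1.1 t.1.2 t.2]].

(* Each label [w] cuts [P] in two and its edges form a matching across the cut, while
   edges with other labels do not cross it; charge the edges to the smaller side. *)
Lemma card_cut_triples (V : finType) (E : V -> V -> V -> bool) (phi : rel V)
    (P Q : {set V}) :
  (forall u u' w, E u u' w = E u' u w) ->
  (forall u u' w, w \in Q -> u \in P -> u' \in P -> E u u' w -> phi w u != phi w u') ->
  (forall u u' w w', w \in Q -> w' \in Q -> u \in P -> u' \in P -> E u u' w ->
     w' != w -> phi w' u = phi w' u') ->
  (forall u u' u'' w, w \in Q -> u \in P -> u' \in P -> u'' \in P ->
     E u u' w -> E u u'' w -> u' = u'') ->
  #|triples E P P Q| <= 2 * (#|P| * trunc_log 2 #|P|).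
Proof.
move=> Esym; have [m] := ubnP #|Q|; elim: m => // m IH in P Q *.
move=> /ltnSE leQm cut ncut mat.
have [->|[w wQ]] := set_0Vmem Q.
  by rewrite (_ : triples _ _ _ _ = set0) ?cards0 //; apply/setP=> t; rewrite !inE !andbF.
pose P0 := [set u in P | phi w u]; pose P1 := [set u in P | ~~ phi w u].
have cP : #|P| = #|P0| + #|P1|.
  rewrite -(cardsID [set u | phi w u] P); congr (_ + _); apply: eq_card => u;
  by rewrite !inE // andbC.
have sub0 u : u \in P0 -> u \in P by rewrite inE => /andP[].
have sub1 u : u \in P1 -> u \in P by rewrite inE => /andP[].
have subQ w' : w' \in Q :\ w -> w' \in Q by rewrite inE => /andP[].
have cQ : #|Q :\ w| < m by rewrite (cardsD1 w Q) wQ in leQm; lia.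
have IH0 := IH P0 (Q :\ w) cQ.
have {}IH0 : #|triples E P0 P0 (Q :\ w)| <= 2 * (#|P0| * trunc_log 2 #|P0|).
  apply: IH0 => [u u' z|u u' z z'|u u' u'' z] *; [apply: cut|apply: (@ncut u u' z)|apply: (@mat u u' u'' z)]; auto.
have IH1 := IH P1 (Q :\ w) cQ.
have {}IH1 : #|triples E P1 P1 (Q :\ w)| <= 2 * (#|P1| * trunc_log 2 #|P1|).
  apply: IH1 => [u u' z|u u' z z'|u u' u'' z] *; [apply: cut|apply: (@ncut u u' z)|apply: (@mat u u' u'' z)]; auto.
(* The edges labelled [w] are counted in both orders; each order is a matching across the cut, hence
   no larger than the smaller side. *)
pose X01 := triples E P0 P1 [set w]; pose X10 := triples E P1 P0 [set w].
have inX01 t : t \in X01 -> [/\ t.1.1 \in P0, t.1.2 \in P1, t.2 = w & E t.1.1 t.1.2 w].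
  by rewrite inE => /and4P[? ?]; rewrite inE => /eqP -> ?.
have inX10 t : t \in X10 -> [/\ t.1.1 \in P1, t.1.2 \in P0, t.2 = w & E t.1.1 t.1.2 w].
  by rewrite inE => /and4P[? ?]; rewrite inE => /eqP -> ?.
have leX (X : {set V * V * V}) (A B : {set V}) : A \subset P -> B \subset P ->
    (forall t, t \in X -> [/\ t.1.1 \in A, t.1.2 \in B, t.2 = w & E t.1.1 t.1.2 w]) ->
    #|X| <= minn #|A| #|B|.
  move=> /subsetP AP /subsetP BP inX; rewrite leq_min; apply/andP; split.
    apply: (@leq_card_inj_in _ _ (fun t => t.1.1)) => [[[a b] c] [[a' b'] c']|t] /=.
      move=> /inX /= [aA bB -> e] /inX /= [aA' bB' -> e'] eqa; subst a'.
      by rewrite (mat _ _ _ _ wQ (AP _ aA) (BP _ bB) (BP _ bB') e e').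
    by case/inX.
  apply: (@leq_card_inj_in _ _ (fun t => t.1.2)) => [[[a b] c] [[a' b'] c']|t] /=.
    move=> /inX /= [aA bB -> e] /inX /= [aA' bB' -> e'] eqb; subst b'.
    rewrite Esym in e; rewrite Esym in e'.
    by rewrite (mat _ _ _ _ wQ (BP _ bB) (AP _ aA) (AP _ aA') e e').
  by case/inX.
have P0P : P0 \subset P by apply/subsetP.
have P1P : P1 \subset P by apply/subsetP.
have c01 := leX X01 P0 P1 P0P P1P inX01.
have c10 := leX X10 P1 P0 P1P P0P inX10.
have cov : triples E P P Q \subset
    (triples E P0 P0 (Q :\ w) :|: triples E P1 P1 (Q :\ w)) :|: (X01 :|: X10).
  apply/subsetP=> -[[u u'] z]; rewrite /X01 /X10 !inE /= => /and4P[uP u'P zQ e].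
  rewrite uP u'P zQ e /=; have [zw|zw] := eqVneq z w.
    subst z; have := cut _ _ _ wQ uP u'P e.
    by case: (phi w u); case: (phi w u').
  have -> := ncut _ _ _ _ zQ wQ uP u'P e _; last by rewrite eq_sym.
  by case: (phi w u').
have c0 := leq_card_cover2 (subxx _) IH0 IH1.
have c1 := leq_card_cover2 (subxx _) c01 c10.
have := leq_card_cover2 cov c0 c1.
rewrite cP; case: (leqP #|P0| #|P1|) => [|/ltnW] /mul_trunc_logD.
  by move: (_ * trunc_log _ (_ + _)) #|triples _ _ _ _| => X Y; lia.
rewrite (addnC #|P1| #|P0|).
by move: (_ * trunc_log _ (_ + _)) #|triples _ _ _ _| => X Y; lia.
Qed.

(** * Cyclic triangles in tripartite tournaments *)

Section CyclicTriangles.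

Variables (V : finType) (part : V -> 'I_3) (D : rel V).

Definition dcycle p q s :=
  [&& part p != part q, part q != part s, part p != part s, D p q, D q s & D s p].

(** A directed triangle runs through the parts in one of two cyclic orders; only the order given by
    [ordS] is kept here. *)
Definition ocycle p q s :=
  [&& part q == ordS (part p), part s == ordS (part q), D p q, D q s & D s p].

Definition obase (U : {set V}) p :=
  [set x : V * V | [&& x.1 \in U, x.2 \in U & ocycle p x.1 x.2]].

Lemma ordS3 (i : 'I_3) : ordS (ordS (ordS i)) = i.
Proof. by apply/val_inj; case: i => [[|[|[|]]]]. Qed.

Lemma ordS3_neq (i : 'I_3) :
  (((i == ordS i) = false) * ((i == ordS (ordS i)) = false) *
   ((ordS i == i) = false) * ((ordS (ordS i) == i) = false))%type.
Proof. by case: i => [[|[|[|]]]]. Qed.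

Definition ordS3E := (ordS3, ordS3_neq).

Lemma ocycle_rot p q s : ocycle p q s -> ocycle q s p.
Proof.
case/and5P=> /eqP pq /eqP qs Dpq Dqs Dsp; apply/and5P; split=> //.
  by rewrite qs.
by rewrite qs pq ordS3.
Qed.

Lemma ocycle_dcycle p q s : ocycle p q s -> dcycle p q s.
Proof.
case/and5P=> /eqP pq /eqP qs Dpq Dqs Dsp.
by rewrite /dcycle Dpq Dqs Dsp qs pq !ordS3E.
Qed.

Definition tournament_on (U : {set V}) := forall p q, p \in U -> q \in U ->
  part p != part q -> D p q = ~~ D q p.

Definition edge_disjoint_on (U : {set V}) := forall p q s s',
  p \in U -> q \in U -> s \in U -> s' \in U ->
  dcycle p q s -> dcycle p q s' -> s = s'.

Section Dense.

Variable U : {set V}.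
Hypotheses (tour : tournament_on U) (disj : edge_disjoint_on U).

(** Cycles through [p] with the same successor share the edge to it. Together with [obase_snd], the
    base edges at [p] form a matching. *)
Lemma obase_fst x y p : p \in U -> x \in obase U p -> y \in obase U p ->
  x.1 = y.1 -> x = y.
Proof.
case: x y => [x1 x2] [y1 y2] pU; rewrite !inE /= => /and3P[x1U x2U ox] /and3P[y1U y2U oy] exy.
subst y1; congr pair.
by apply: (disj pU x1U x2U y2U); exact: ocycle_dcycle.
Qed.

Lemma obase_snd x y p : p \in U -> x \in obase U p -> y \in obase U p ->
  x.2 = y.2 -> x = y.
Proof.
case: x y => [x1 x2] [y1 y2] pU; rewrite !inE /= => /and3P[x1U x2U ox] /and3P[y1U y2U oy] exy.
subst y2; congr pair.
by apply: (disj x2U pU x1U y1U); apply/ocycle_dcycle/ocycle_rot/ocycle_rot.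
Qed.

(** Otherwise [p -> x.1 -> y.2 -> p] shares [p -> x.1] with the cycle of [x], which forces
    [y.2 = x.2]. *)
Lemma obase_back x y p : p \in U -> x \in obase U p -> y \in obase U p ->
  x != y -> D y.2 x.1.
Proof.
move=> pU xp yp; apply: contraR => nD.
have := xp; have := yp; rewrite !inE => /and3P[y1U y2U oy] /and3P[x1U x2U ox].
case/and5P: (ox) => /eqP px /eqP xx Dpx _ _.
case/and5P: (oy) => /eqP py /eqP yy _ _ Dyp.
apply/eqP/(obase_snd pU) => //; apply: (disj pU x1U x2U y2U).
  exact: ocycle_dcycle.
have pne : part x.1 != part y.2 by rewrite yy py px !ordS3E.
by rewrite /dcycle pne Dpx Dyp (tour x1U y2U pne) nD px yy py !ordS3E.
Qed.

(* Otherwise two cycles of the form [x.1 -> p' -> y.2 -> x.1] share an edge at [p']. *)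
Lemma obase_uniform p p' : p \in U -> p' \in U -> part p' = part p -> p' != p ->
  4 < #|obase U p| ->
  (forall x, x \in obase U p -> D p' x.1 /\ D p' x.2) \/
  (forall x, x \in obase U p -> D x.1 p' /\ D x.2 p').
Proof.
move=> pU p'U pp' np' big; set A := obase U p in big *.
have neq1 x : x \in A -> part p' != part x.1.
  by rewrite inE => /and3P[_ _ /and5P[/eqP -> _ _ _ _]]; rewrite pp' ordS3E.
have neq2 x : x \in A -> part p' != part x.2.
  by rewrite inE => /and3P[_ _ /and5P[/eqP e1 /eqP -> _ _ _]]; rewrite e1 pp' ordS3E.
have inU1 x : x \in A -> x.1 \in U by rewrite inE => /and3P[].
have inU2 x : x \in A -> x.2 \in U by rewrite inE => /and3P[].
pose P := [set x in A | D p' x.2]; pose Q := [set x in A | D x.1 p'].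
(* Otherwise [x.1 -> x.2 -> p' -> x.1] shares an edge with the cycle of [x] through [p]. *)
have APQ : A = P :|: Q.
  apply/setP=> x; rewrite !inE -/A; case xA: (x \in obase U p) => /=; last by rewrite !inE in xA *; rewrite xA.
  rewrite !inE in xA; rewrite xA /=; apply/esym/negPn/negP; rewrite negb_or => /andP[nP nQ].
  have {}xA : x \in A by rewrite inE.
  have := xA; rewrite inE => /and3P[x1U x2U ox].
  case/and5P: (ox) => /eqP px /eqP xx Dpx Dx _.
  case/negP: np'; apply/eqP; apply/esym/(disj x1U x2U pU p'U).
    exact/ocycle_dcycle/ocycle_rot.
  rewrite /dcycle Dx xx px pp' !ordS3E /= (tour x2U p'U) ?nP; last by rewrite eq_sym neq2.
  by rewrite (tour p'U x1U) ?nQ ?neq1.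
have cross x y : x \in Q -> y \in P -> x != y -> dcycle x.1 p' y.2.
  rewrite !inE => /andP[xA Dx] /andP[yA Dy] nxy.
  have {}xA : x \in A by rewrite inE.
  have {}yA : y \in A by rewrite inE.
  rewrite /dcycle Dx Dy (obase_back pU xA yA nxy) neq2 // eq_sym neq1 //=.
  move: xA yA; rewrite !inE => /and3P[_ _ /and5P[/eqP px _ _ _ _]].
  by move=> /and3P[_ _ /and5P[/eqP py /eqP -> _ _ _]]; rewrite px py !ordS3E.
have PA x : x \in P -> x \in A by rewrite inE => /andP[].
have QA x : x \in Q -> x \in A by rewrite inE => /andP[].
have smallP x : x \in Q -> #|P :\ x| <= 1.
  move=> xQ; rewrite leqNgt; apply/negP => /card_gt1P[y [z [yP zP /negP[]]]].
  move: yP zP; rewrite !in_setD1 => /andP[yx yP] /andP[zx zP]; apply/eqP.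
  apply: (obase_snd pU (PA _ yP) (PA _ zP)).
  apply: (disj (inU1 _ (QA _ xQ)) p'U (inU2 _ (PA _ yP)) (inU2 _ (PA _ zP)));
    by apply: cross; rewrite // eq_sym.
have smallQ y : y \in P -> #|Q :\ y| <= 1.
  move=> yP; rewrite leqNgt; apply/negP => /card_gt1P[x [z [xQ zQ /negP[]]]].
  move: xQ zQ; rewrite !in_setD1 => /andP[xy xQ] /andP[zy zQ]; apply/eqP.
  have rot a b c : dcycle a b c -> dcycle b c a.
    by case/and5P=> h1 h2 h3 h4 /andP[h5 h6]; rewrite /dcycle h2 h4 h5 h6 (eq_sym (part c)) h3 eq_sym h1.
  apply: (obase_fst pU (QA _ xQ) (QA _ zQ)).
  apply: (disj p'U (inU2 _ (PA _ yP)) (inU1 _ (QA _ xQ)) (inU1 _ (QA _ zQ)));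
    by apply/rot/cross.
have [P0|[y yP]] := set_0Vmem P.
  right=> x xA; have xP : x \notin P by rewrite P0 inE.
  have xQ : x \in Q by move: xA; rewrite {1}APQ P0 set0U.
  split; first by move: xQ; rewrite inE => /andP[].
  by rewrite (tour (inU2 _ xA) p'U) 1?eq_sym ?neq2 //; apply: contra xP => h; rewrite inE xA.
have [Q0|[x xQ]] := set_0Vmem Q.
  left=> x xA; have xQ : x \notin Q by rewrite Q0 inE.
  have xP : x \in P by move: xA; rewrite {1}APQ Q0 setU0.
  split; last by move: xP; rewrite inE => /andP[].
  by rewrite (tour p'U (inU1 _ xA)) ?neq1 //; apply: contra xQ => h; rewrite inE xA.
(* With both sets nonempty, each has at most two elements, so there are at most four base edges. *)
have := smallP _ xQ; have := smallQ _ yP.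
have := cardsD1 x P; have := cardsD1 y Q; have := leq_card_setU P Q; rewrite -APQ => -[+ _].
by case: (_ \in _); case: (_ \in _); lia.
Qed.

Lemma other_base p x : 4 < #|obase U p| ->
  exists2 y, y \in obase U p & y != x.
Proof.
move=> big; have : 0 < #|obase U p :\ x| by have := cardsD1 x (obase U p); lia.
by case/card_gt0P=> y; rewrite in_setD1 => /andP[? ?]; exists y.
Qed.

(* Start from a cycle [r -> b -> g -> r], a second cycle [b -> g' -> r' -> b] and a
   second cycle [g -> r'' -> b'' -> g]. By uniformity [g' -> b1 -> r'' -> g'] for every
   [b1] other than [b] in a cycle through [r], so these cycles share [r'' -> g']. *)
Lemma dense_ocycles_empty : (forall p, p \in U -> 4 < #|obase U p|) -> U = set0.
Proof.
move=> big; have [//|[r rU]] := set_0Vmem U; exfalso.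
have [[b g] bg _] := other_base (r, r) (big r rU).
have := bg; rewrite inE /= => /and3P[bU gU org].
have orb := ocycle_rot org; have obr := ocycle_rot orb.
have rg_b : (g, r) \in obase U b by rewrite inE /= gU rU.
have rb_g : (r, b) \in obase U g by rewrite inE /= rU bU.
have [[g' r'] gr' ngr'] := other_base (g, r) (big b bU).
have [[r'' b''] rb'' nrb''] := other_base (r, b) (big g gU).
have := gr'; rewrite inE /= => /and3P[g'U r'U o'].
have := rb''; rewrite inE /= => /and3P[r''U b''U o''].
have g'g : g' != g by apply: contraNneq ngr' => e; apply/eqP/(obase_fst bU gr' rg_b).
have r''r : r'' != r by apply: contraNneq nrb'' => e; apply/eqP/(obase_fst gU rb'' rb_g).
case/and5P: (org) => /eqP pb /eqP pg Drb Dbg Dgr.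
case/and5P: (o') => /eqP pg' /eqP pr' Dbg' Dg'r' Dr'b.
case/and5P: (o'') => /eqP pr'' /eqP pb'' Dgr'' Dr''b'' Db''g.
have part_g' : part g' = part g by rewrite pg' pg.
have part_r'' : part r'' = part r by rewrite pr'' pg pb ordS3.
have Drg' : D r g'.
  rewrite (tour rU g'U); last by rewrite part_g' pg pb ordS3E.
  apply: contra g'g => Dg'r; apply/eqP/esym/(disj rU bU gU g'U).
    exact: ocycle_dcycle.
  by rewrite /dcycle Drb Dbg' Dg'r part_g' pg pb !ordS3E.
(* [g'] stands in the same relation to all base vertices of [g], among them [r] and [r'']. The
   arrows [g' -> b1] and [b1 -> r''] below arise in the same way from the bases of [b] and [r]. *)
have Dr''g' : D r'' g'.
  have [hU|hU] := obase_uniform gU g'U part_g' g'g (big g gU).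
    have [D1 _] := hU _ rb_g; move: D1; rewrite /= (tour g'U rU) ?Drg' //.
    by rewrite part_g' pg pb eq_sym ordS3E.
  by have [] := hU _ rb''.
have noty b1 g1 : (b1, g1) \in obase U r -> (b1, g1) != (b, g) -> dcycle r'' g' b1.
  move=> b1g1 nb; have := b1g1; rewrite inE /= => /and3P[b1U g1U o1].
  case/and5P: (o1) => /eqP pb1 /eqP pg1 Drb1 _ _.
  have b1b : b1 != b by apply: contraNneq nb => e; apply/eqP/(obase_fst rU b1g1 bg).
  have part_b1 : part b1 = part b by rewrite pb1 pb.
  have Dg'b1 : D g' b1.
    have [hU|hU] := obase_uniform bU b1U part_b1 b1b (big b bU).
      have [_] := hU _ rg_b; rewrite /= (tour b1U rU) ?Drb1 //.
      by rewrite part_b1 pb eq_sym ordS3E.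
    by have [] := hU _ gr'.
  have Db1r'' : D b1 r''.
    have [hU|hU] := obase_uniform rU r''U part_r'' r''r (big r rU).
      have [_] := hU _ bg; rewrite /= (tour r''U gU) ?Dgr'' //.
      by rewrite part_r'' pg pb ordS3E.
    by have [] := hU _ b1g1.
  by rewrite /dcycle Dr''g' Dg'b1 Db1r'' part_r'' part_g' part_b1 pg pb !ordS3E.
have : 1 < #|obase U r :\ (b, g)|.
  have := big r rU; rewrite (cardsD1 (b, g)) bg add1n ltnS; exact: leq_trans.
case/card_gt1P=> -[b1 g1] [[b2 g2] []]; rewrite !in_setD1 => /andP[n1 m1] /andP[n2 m2].
case/negP; apply/eqP/(obase_fst rU m1 m2) => /=.
apply: (disj r''U g'U _ _ (noty _ _ m1 n1) (noty _ _ m2 n2)).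
  by move: m1; rewrite inE => /and3P[].
by move: m2; rewrite inE => /and3P[].
Qed.

End Dense.

(** By [dense_ocycles_empty] some vertex [p] has at most four base edges. Each cycle through [p]
    occurs in three rotations, so deleting [p] loses at most 12 triples. *)
Lemma card_ocycles (U : {set V}) : tournament_on U -> edge_disjoint_on U ->
  #|triples ocycle U U U| <= 12 * #|U|.
Proof.
have [m] := ubnP #|U|; elim: m => // m IH in U *; move=> /ltnSE leUm tour disj.
have [U0|[p0 p0U]] := set_0Vmem U.
  by rewrite (_ : triples _ _ _ _ = set0) ?cards0 //; apply/setP=> t; rewrite U0 !inE.
have /existsP[p /andP[pU small]] : [exists p, (p \in U) && (#|obase U p| <= 4)].
  apply/existsP; apply/existsP; apply: contraT; rewrite negb_exists => /forallP big.
  have U0 : U = set0.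
    apply: dense_ocycles_empty => // p pU; have := big p; rewrite pU /=; lia.
  by rewrite U0 inE in p0U.
have subU q : q \in U :\ p -> q \in U by rewrite inE => /andP[].
have cU : #|U| = #|U :\ p|.+1 by rewrite (cardsD1 p U) pU.
have IHp : #|triples ocycle (U :\ p) (U :\ p) (U :\ p)| <= 12 * #|U :\ p|.
  apply: IH; first lia.
    by move=> a b *; apply: tour; auto.
  by move=> a b c d *; apply: (@disj a b c d); auto.
pose B := obase U p.
have cov : triples ocycle U U U \subset
   triples ocycle (U :\ p) (U :\ p) (U :\ p) :|:
   ([set (p, x.1, x.2) | x in B] :|: ([set (x.2, p, x.1) | x in B] :|:
    [set (x.1, x.2, p) | x in B])).
  apply/subsetP=> -[[a b] c]; rewrite inE /= => /and4P[aU bU cU' o].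
  have [ap|ap] := eqVneq a p.
    subst a; rewrite inE; apply/orP; right; rewrite inE; apply/orP; left.
    by apply/imsetP; exists (b, c) => //; rewrite inE /= bU cU'.
  have [bp|bp] := eqVneq b p.
    subst b; do 2 (rewrite inE; apply/orP; right); rewrite inE; apply/orP; left.
    by apply/imsetP; exists (c, a) => //; rewrite inE /= aU cU' (ocycle_rot o).
  have [cp|cp] := eqVneq c p.
    subst c; do 3 (rewrite inE; apply/orP; right).
    by apply/imsetP; exists (a, b) => //; rewrite inE /= aU bU (ocycle_rot (ocycle_rot o)).
  by rewrite !inE /= ap bp cp aU bU cU' o.
have i1 := leq_trans (leq_imset_card (fun x : V * V => (p, x.1, x.2)) B) small.
have i2 := leq_trans (leq_imset_card (fun x : V * V => (x.2, p, x.1)) B) small.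
have i3 := leq_trans (leq_imset_card (fun x : V * V => (x.1, x.2, p)) B) small.
have i23 := leq_card_cover2 (subxx _) i2 i3.
have := leq_card_cover2 cov IHp (leq_card_cover2 (subxx _) i1 i23).
by rewrite cU mulnS addnC.
Qed.

End CyclicTriangles.

(** * Triangles crossing the neighbourhoods of a vertex *)

Lemma leq_card_bigcup (I T : finType) (A : {set T}) (B : I -> {set T}) (m : I -> nat) :
  A \subset \bigcup_i B i -> (forall i, #|B i| <= m i) -> #|A| <= \sum_i m i.
Proof.
move=> /subset_leq_card sAB leB; apply: leq_trans sAB _.
apply: (big_ind2 (fun (X : {set T}) n => #|X| <= n)).
- by rewrite cards0.
- by move=> X x Y y leX leY; exact: leq_card_cover2 (subxx _) leX leY.
- by move=> i _; exact: leB.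
Qed.

(* No distinctness of the vertices is required: for symmetric [col] it follows. *)
Definition rainbow3 (V : Type) (C : eqType) (col : V -> V -> C) a b c :=
  [&& col a b != col b c, col b c != col a c & col a b != col a c].

Section Rainbow3.

Variables (V C : eqType) (col : V -> V -> C).
Hypothesis colC : forall a b, col a b = col b a.

Local Notation rb := (rainbow3 col).

Lemma rainbow3_swapl a b c : rb a b c = rb b a c.
Proof. by rewrite /rainbow3 (colC b a) andbCA andbA andbC (eq_sym (col a c)). Qed.

Lemma rainbow3_swapr a b c : rb a b c = rb a c b.
Proof.
rewrite /rainbow3 (colC c b) (eq_sym (col a c) (col b c)) (eq_sym (col a c) (col a b)).
rewrite (eq_sym (col b c) (col a b)).
by case: (col a b == col b c); case: (col b c == col a c); case: (col a b == col a c).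
Qed.

Lemma rainbow3_neq a b c : rb a b c -> [/\ a != b, b != c & a != c].
Proof.
case/and3P=> h1 h2 h3; split.
- by apply: contraNneq h2 => ->.
- by apply: contraNneq h3 => ->.
- by apply: contraNneq h1 => ->; rewrite colC.
Qed.

End Rainbow3.

Section ThreeColours.

Variables (V : finType) (col : V -> V -> 'I_3).
Hypothesis colC : forall a b, col a b = col b a.

Local Notation rb := (rainbow3 col).

Hypothesis disj : forall a b c d, rb a b c -> rb a b d -> c = d.

Lemma rainbow3_uniql a b c d : rb c a b -> rb d a b -> c = d.
Proof. by rewrite 2!(rainbow3_swapl colC _ a) 2!(rainbow3_swapr colC a _ b); exact: disj. Qed.

Lemma rainbow3_uniqm a b c d : rb a c b -> rb a d b -> c = d.
Proof. by rewrite 2!(rainbow3_swapr colC a _ b); exact: disj. Qed.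

(* Every rainbow triangle has exactly one ordering of this kind. *)
Definition tri a b c :=
  [&& val (col b c) == 0, val (col a c) == 1 & val (col a b) == 2].

Lemma tri_rainbow3 a b c : tri a b c -> rb a b c.
Proof.
case/and3P=> /eqP h0 /eqP h1 /eqP h2.
by rewrite /rainbow3 -!val_eqE /= h0 h1 h2.
Qed.

Definition num_tri (U : {set V}) := #|triples tri U U U|.

Section Clean.

Variables (kappa : V -> 'I_3) (W : {set V}).
Hypothesis clean : forall p q, p \in W -> q \in W -> kappa p != kappa q ->
  (col p q == kappa p) || (col p q == kappa q).

(** In the application [kappa p] is the colour of the edge from a fixed vertex to [p], so the
    classes are colour neighbourhoods. *)
Definition class i := [set u in W | kappa u == i].
(** Empty for [k = i], so that sums can range over all pairs of colours. *)
Definition classN i k := [set w in W | (kappa w == k) && (kappa w != i)].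

(** A vertex [w] of class [k] cuts class [i] by the colour of its edges, which is [i] or [k]. An
    edge [u u'] in a rainbow triangle with [w] crosses this cut and has the third colour. If another
    [w'] also separated [u] from [u'], it would form a second rainbow triangle on [u u']. So
    [card_cut_triples] applies. *)
Lemma card_clean_two_one i k :
  #|triples rb (class i) (class i) (classN i k)| <= 2 * (#|W| * trunc_log 2 #|W|).
Proof.
pose P := class i; pose Q := classN i k.
have PQ u w : u \in P -> w \in Q ->
    [/\ kappa u = i, kappa w = k, k != i & (col w u == k) || (col w u == i)].
  rewrite !inE => /andP[uW /eqP ui] /and3P[wW /eqP wk nwi].
  have kw : kappa w != kappa u by rewrite ui.
  by have := clean wW uW kw; rewrite ui wk; split=> //; rewrite -wk.
have phiE u u' w : u \in P -> u' \in P -> w \in Q ->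
    ((col w u == kappa w) != (col w u' == kappa w)) = (col w u != col w u').
  move=> uP u'P wQ; have [ui wk nki hu] := PQ _ _ uP wQ; have [_ _ _ hu'] := PQ _ _ u'P wQ.
  rewrite wk; case/orP: hu => /eqP ->; case/orP: hu' => /eqP ->; rewrite ?eqxx //.
    by rewrite (eq_sym i k) (negbTE nki).
  by rewrite (eq_sym i k) (negbTE nki).
have sPW : #|P| <= #|W| by apply/subset_leq_card/subsetP=> u; rewrite inE => /andP[].
apply: leq_trans (card_cut_triples (phi := fun w u => col w u == kappa w) _ _ _ _) _.
- by move=> u u' w; rewrite (rainbow3_swapl colC).
- move=> u u' w wQ uP u'P /and3P[_ h _]; rewrite phiE //.
  by rewrite (colC w) (colC w) eq_sym.
- move=> u u' w w' wQ w'Q uP u'P e nw; apply: contraNeq nw; rewrite phiE // => h.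
  apply/eqP; apply: (@disj u u') => //.
  have [_ _ nki hu] := PQ _ _ uP wQ; have [_ _ _ hu'] := PQ _ _ u'P wQ.
  have [_ _ _ gu] := PQ _ _ uP w'Q; have [_ _ _ gu'] := PQ _ _ u'P w'Q.
  move: e h; rewrite /rainbow3 !(colC _ w) !(colC _ w').
  have nik : i != k by rewrite eq_sym.
  by case/orP: hu => /eqP ->; case/orP: hu' => /eqP ->; case/orP: gu => /eqP ->;
     case/orP: gu' => /eqP ->; rewrite ?eqxx ?andbF //= => /and3P[h1 _ h3] _;
     rewrite h1 h3 ?nik ?nki.
- by move=> u u' u'' w _ _ _ _; exact: rainbow3_uniqm.
rewrite leq_mul2l /= leq_mul //; exact: leq_trunc_log.
Qed.

Definition beats p q := col p q == kappa p.

(** An edge between classes carries the class colour of exactly one end. [f] renames the parts, so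
    that [rev_ord] can exchange the two cyclic orders. *)
Lemma beats_tournament (f : 'I_3 -> 'I_3) : tournament_on (f \o kappa) beats W.
Proof.
move=> p q pW qW npq; have npq' : kappa p != kappa q by apply: contraNneq npq => /= ->.
rewrite /beats (colC q p); case/orP: (clean pW qW npq') => /eqP ->; rewrite eqxx.
  by rewrite npq'.
by rewrite eq_sym (negbTE npq').
Qed.

(** Each edge of a directed cycle has the class colour of its tail, so the cycle is a rainbow
    triangle. *)
Lemma beats_edge_disjoint (f : 'I_3 -> 'I_3) : edge_disjoint_on (f \o kappa) beats W.
Proof.
have rbE p q s : dcycle (f \o kappa) beats p q s -> rb p q s.
  case/and5P=> /= n1 n2 n3 /eqP d1 /andP[/eqP d2 /eqP d3].
  rewrite /rainbow3 d1 d2 colC d3.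
  apply/and3P; split; [by apply: contraNneq n1 => ->|by apply: contraNneq n2 => ->|].
  by apply: contraNneq n3 => ->.
by move=> p q s s' _ _ _ _ /rbE h /rbE h'; exact: disj h h'.
Qed.

(** A triangle that is not cyclic has a vertex beating both others, and then two edges of the same
    colour. *)
Lemma clean_rainbow_cycle a b c : a \in W -> b \in W -> c \in W ->
  kappa a != kappa b -> kappa b != kappa c -> kappa a != kappa c -> rb a b c ->
  [&& beats a b, beats b c & beats c a] || [&& beats a c, beats c b & beats b a].
Proof.
move=> aW bW cW nab nbc nac; rewrite /beats /rainbow3 (colC c a) (colC c b) (colC b a).
have := clean aW bW nab; have := clean bW cW nbc; have := clean aW cW nac.
by case/orP=> /eqP ->; case/orP=> /eqP ->; case/orP=> /eqP ->;
  rewrite !eqxx /= ?andbF ?orbT.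
Qed.

Lemma ordS3_cycle (i j k : 'I_3) : i != j -> j != k -> i != k ->
  ((j == ordS i) && (k == ordS j)) ||
  ((rev_ord j == ordS (rev_ord i)) && (rev_ord k == ordS (rev_ord j))).
Proof.
by case: i => [[|[|[|]]] ?] //; case: j => [[|[|[|]]] ?] //; case: k => [[|[|[|]]] ?].
Qed.

Definition not_one_class (t : V * V * V) :=
  ~~ ((kappa t.1.1 == kappa t.1.2) && (kappa t.1.2 == kappa t.2)).

(** For two vertices in one class there are three positions of the odd vertex and nine pairs of
    classes, each costing [2 |W| log |W|]. Triangles with three classes are oriented cycles for one
    of two vertex orders and one of two orders of the classes, each of the four families costing
    [12 |W|]. *)
Lemma card_clean_cross :
  #|[set t in triples tri W W W | not_one_class t]| <=
    #|W| * (54 * trunc_log 2 #|W| + 48).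
Proof.
set F := [set t in _ | _].
have inF t : t \in F -> [/\ t.1.1 \in W, t.1.2 \in W, t.2 \in W & rb t.1.1 t.1.2 t.2].
  by rewrite !inE => /andP[/and4P[? ? ? /tri_rainbow3]].
pose m2 := 2 * (#|W| * trunc_log 2 #|W|); pose m3 := 12 * #|W|.
pose rot (t : V * V * V) := (t.1.2, t.2, t.1.1).
pose swp (t : V * V * V) := (t.1.1, t.2, t.1.2).
have rot_inj : injective rot by move=> [[a b] c] [[a' b'] c'] [-> -> ->].
have swp_inj : injective swp by move=> [[a b] c] [[a' b'] c'] [-> -> ->].
pose two (f : V * V * V -> V * V * V) := \bigcup_(ik : 'I_3 * 'I_3)
  f @^-1: triples rb (class ik.1) (class ik.1) (classN ik.1 ik.2).
have two_le f : injective f -> #|two f| <= 9 * m2.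
  move=> injf; have -> : 9 * m2 = \sum_(ik : 'I_3 * 'I_3) m2
    by rewrite sum_nat_const card_prod card_ord.
  apply: (leq_card_bigcup (subxx _)) => ik.
  apply: leq_trans (card_clean_two_one ik.1 ik.2).
  by apply: (@leq_card_inj_in _ _ f) => [x y _ _ /injf|x]; rewrite ?inE.
have two_id := two_le id (fun x y e => e).
have two_rot := two_le rot rot_inj.
have two_swp := two_le swp swp_inj.
pose one (f : V * V * V -> V * V * V) (g : 'I_3 -> 'I_3) := f @^-1: triples (ocycle (g \o kappa) beats) W W W.
have one_le f g : injective f -> #|one f g| <= m3.
  move=> injf; apply: leq_trans (card_ocycles (@beats_tournament g) (@beats_edge_disjoint g)).
  by apply: (@leq_card_inj_in _ _ f) => [x y _ _ /injf|x]; rewrite ?inE.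
have o1 := one_le id id (fun x y e => e).
have o2 := one_le id (@rev_ord 3) (fun x y e => e).
have o3 := one_le swp id swp_inj.
have o4 := one_le swp (@rev_ord 3) swp_inj.
have cov : F \subset (two id :|: (two rot :|: two swp)) :|:
    ((one id id :|: one id (@rev_ord 3)) :|: (one swp id :|: one swp (@rev_ord 3))).
  apply/subsetP=> -[[a b] c] tF; have [/= aW bW cW rabc] := inF _ tF.
  have := tF; rewrite inE => /andP[_]; rewrite /not_one_class /= => nall.
  have [kab|nab] := eqVneq (kappa a) (kappa b).
    rewrite inE; apply/orP; left; rewrite inE; apply/orP; left.
    apply/bigcupP; exists (kappa a, kappa c) => //; rewrite !inE /= aW bW cW kab !eqxx rabc /= andbT.
    by move: nall; rewrite kab eqxx /= eq_sym.
  have [kbc|nbc] := eqVneq (kappa b) (kappa c).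
    rewrite inE; apply/orP; left; rewrite inE; apply/orP; right; rewrite inE; apply/orP; left.
    apply/bigcupP; exists (kappa b, kappa a) => //; rewrite !inE /= aW bW cW -kbc !eqxx nab /=.
    by rewrite -(rainbow3_swapr colC b a c) -(rainbow3_swapl colC).
  have [kac|nac] := eqVneq (kappa a) (kappa c).
    rewrite inE; apply/orP; left; rewrite inE; apply/orP; right; rewrite inE; apply/orP; right.
    apply/bigcupP; exists (kappa a, kappa b) => //; rewrite !inE /= aW bW cW kac !eqxx /=.
    by rewrite nbc -(rainbow3_swapr colC).
  rewrite inE; apply/orP; right; rewrite !inE /= aW bW cW /ocycle /=.
  have /orP[/and3P[-> -> ->]|/and3P[-> -> ->]] := clean_rainbow_cycle aW bW cW nab nbc nac rabc.
    by rewrite !andbT !andbA; case/orP: (ordS3_cycle nab nbc nac) => ->; rewrite ?orbT.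
  have ncb : kappa c != kappa b by rewrite eq_sym.
  by rewrite !andbT !andbA; case/orP: (ordS3_cycle nac ncb nab) => ->; rewrite ?orbT.
have := leq_card_cover2 cov (leq_card_cover2 (subxx _) two_id (leq_card_cover2 (subxx _) two_rot two_swp))
  (leq_card_cover2 (subxx _) (leq_card_cover2 (subxx _) o1 o2) (leq_card_cover2 (subxx _) o3 o4)).
move/leq_trans; apply; rewrite /m2 /m3; lia.
Qed.

End Clean.

(** These are the triangles lost when [U] is split into the three colour neighbourhoods of [v]. *)
Definition cross_tri (v : V) (U : {set V}) :=
  [set t in triples tri U U U | ~~ [&& t.1.1 != v, t.1.2 != v, t.2 != v &
     ~~ not_one_class (col v) t]].

Lemma card_rainbow3_link v a : #|[set u | rb v a u]| <= 1.
Proof.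
rewrite leqNgt; apply/negP=> /card_gt1P[x [y []]]; rewrite !inE => hx hy /negP[].
by apply/eqP; exact: disj hx hy.
Qed.

Lemma card_tri_through v (U : {set V}) :
  #|[set t in triples tri U U U | [|| t.1.1 == v, t.1.2 == v | t.2 == v]]| <= 3 * #|U|.
Proof.
pose A (f : V * V * V -> V) := [set t in triples tri U U U | f t == v].
pose p1 (t : V * V * V) := t.1.1; pose p2 (t : V * V * V) := t.1.2.
pose p3 (t : V * V * V) := t.2.
have inA f t : t \in A f -> [/\ t.1.1 \in U, t.1.2 \in U, t.2 \in U, rb t.1.1 t.1.2 t.2 & f t = v].
  by rewrite !inE => /andP[/and4P[? ? ? /tri_rainbow3 ?] /eqP].
have c1 : #|A p1| <= #|U|.
  apply: (@leq_card_inj_in _ _ p2) => [[[a b] c] [[a' b'] c'] /inA /= [_ _ _ h ea] /inA /= [_ _ _ h' ea'] e|t /inA[]//].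
  by rewrite /p1 /p2 /= in ea ea' e; subst; rewrite (disj h h').
have c2 : #|A p2| <= #|U|.
  apply: (@leq_card_inj_in _ _ p1) => [[[a b] c] [[a' b'] c'] /inA /= [_ _ _ h ea] /inA /= [_ _ _ h' ea'] e|t /inA[]//].
  by rewrite /p1 /p2 /= in ea ea' e; subst; rewrite (disj h h').
have c3 : #|A p3| <= #|U|.
  apply: (@leq_card_inj_in _ _ p1) => [[[a b] c] [[a' b'] c'] /inA /= [_ _ _ h ea] /inA /= [_ _ _ h' ea'] e|t /inA[]//].
  by rewrite /p1 /p3 /= in ea ea' e; subst; rewrite (rainbow3_uniqm h h').
have cov : [set t in triples tri U U U | [|| t.1.1 == v, t.1.2 == v | t.2 == v]] \subset
    A p1 :|: (A p2 :|: A p3).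
  by apply/subsetP=> t; rewrite !inE => /andP[-> h]; exact: h.
apply: leq_trans (leq_card_cover2 cov c1 (leq_card_cover2 (subxx _) c2 c3)) _; lia.
Qed.

(** Call the vertex completing the edge [v u] to a rainbow triangle, if any, the partner of [u]. A
    random [H] contains the three vertices of a triangle and avoids their partners with probability
    at least [2 ^ -6]. The vertices of [H] without partner in [H] form a clean set, to which
    [card_clean_cross] applies. *)
Lemma card_cross_tri v (U : {set V}) :
  #|cross_tri v U| <= 35 * 100 * (#|U| * (trunc_log 2 #|U|).+1).
Proof.
pose F := [set t in triples tri (U :\ v) (U :\ v) (U :\ v) | not_one_class (col v) t].
pose A (t : V * V * V) := [set t.1.1; t.1.2; t.2].
pose L a := [set u | rb v a u].
pose B (t : V * V * V) := L t.1.1 :|: (L t.1.2 :|: L t.2).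
have inF t : t \in F -> [/\ t.1.1 != v, t.1.2 != v, t.2 != v & rb t.1.1 t.1.2 t.2].
  by rewrite !inE => /andP[/and4P[/andP[? _] /andP[? _] /andP[? _] /tri_rainbow3]].
(* If one vertex of [t] were the partner of another, their rainbow triangle with [v] would share an
   edge with [t]. *)
have dAB t : t \in F -> [disjoint A t & B t].
  case: t => [[a b] c] /inF /= [nav nbv ncv rabc].
  have nL x y z : rb x y z -> z != v -> (x \in L y) = false.
    move=> r nz; rewrite inE; apply/negP=> r'; case/negP: nz; apply/eqP.
    by apply: (@disj x y) => //; move: r'; rewrite (rainbow3_swapr colC) (rainbow3_swapl colC) (rainbow3_swapr colC).
  have nLL x : (x \in L x) = false.
    by rewrite inE; apply/negP=> /(rainbow3_neq colC)[_]; rewrite eqxx.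
  have rba : rb b a c by rewrite (rainbow3_swapl colC).
  have rac : rb a c b by rewrite (rainbow3_swapr colC).
  have rca : rb c a b by rewrite (rainbow3_swapl colC).
  have rbc : rb b c a by rewrite (rainbow3_swapr colC).
  have rcb : rb c b a by rewrite (rainbow3_swapl colC).
  apply/pred0P=> x /=; apply/negP=> /andP[]; rewrite /A /B /= !inE -!/(L _) => /orP[/orP[]|] /eqP ->.
  - by have := nL _ _ _ rabc ncv; have := nL _ _ _ rac nbv; have := nLL a; rewrite !inE => -> -> ->.
  - by have := nL _ _ _ rba ncv; have := nL _ _ _ rbc nav; have := nLL b; rewrite !inE => -> -> ->.
  - by have := nL _ _ _ rca nbv; have := nL _ _ _ rcb nav; have := nLL c; rewrite !inE => -> -> ->.
have cAB t : t \in F -> #|A t| + #|B t| <= 6.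
  move=> _; have cB : #|B t| <= 1 + (1 + 1).
    by apply: (leq_card_cover2 (subxx _)); rewrite ?card_rainbow3_link //;
       apply: (leq_card_cover2 (subxx _)); rewrite card_rainbow3_link.
  have cA : #|A t| <= 2 + 1.
    by apply: (leq_card_cover2 (subxx _)); rewrite ?cards1 // cards2; case: (_ != _).
  exact: leq_add cA cB.
have [H leF] := exists_popular_set dAB cAB.
pose W := [set u in U | [&& u != v, u \in H & [disjoint L u & H]]].
have clean p q : p \in W -> q \in W -> col v p != col v q ->
    (col p q == col v p) || (col p q == col v q).
  rewrite !inE => /and4P[_ pv pH dL] /and4P[_ qv qH _] npq; apply: contraT.
  rewrite negb_or => /andP[n1 n2]; have : q \in L p.
    by rewrite inE /rainbow3 (eq_sym (col v p)) n1 n2.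
  by move/(disjointFr dL); rewrite qH.
have leW := card_clean_cross clean.
have cWU : #|W| <= #|U| by apply/subset_leq_card/subsetP=> u; rewrite inE => /andP[].
have le1 : #|[set t in F | (A t \subset H) && [disjoint B t & H]]| <=
    #|[set t in triples tri W W W | not_one_class (col v) t]|.
  apply/subset_leq_card/subsetP=> -[[a b] c]; rewrite inE => /andP[tF /andP[/subsetP sA dB]].
  have inH x : x \in A (a, b, c) -> [disjoint L x & H].
    move=> xA; apply: disjointWl dB; apply/subsetP=> y yL; rewrite /B /=.
    by move: xA; rewrite /A /= !inE => /orP[/orP[]|] /eqP <-; move: yL; rewrite inE => ->; rewrite ?orbT.
  have hA := sA; move: tF; rewrite !inE /= => /andP[/and4P[/andP[nav aU] /andP[nbv bU] /andP[ncv cU] ht] ->].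
  have aA : a \in A (a, b, c) by rewrite !inE eqxx.
  have bA : b \in A (a, b, c) by rewrite !inE eqxx orbT.
  have cA : c \in A (a, b, c) by rewrite !inE eqxx orbT.
  by rewrite aU bU cU nav nbv ncv !sA // !inH // ht.
have c1 := card_tri_through v U.
have cov : cross_tri v U \subset
   [set t in triples tri U U U | [|| t.1.1 == v, t.1.2 == v | t.2 == v]] :|: F.
  apply/subsetP=> -[[a b] c]; rewrite !inE /= => /andP[/and4P[-> -> -> ->]] /=.
  by case: (a =P v); case: (b =P v); case: (c =P v) => //= _ _ _; rewrite negbK.
have lF : #|F| <= 64 * (#|W| * (54 * trunc_log 2 #|W| + 48)).
  by apply: leq_trans leF _; rewrite leq_mul2l /=; apply: leq_trans le1 leW.
apply: leq_trans (leq_card_cover2 cov c1 lF) _.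
have lL : trunc_log 2 #|W| <= trunc_log 2 #|U| by exact: leq_trunc_log.
have h : #|W| * (54 * trunc_log 2 #|W| + 48) <= #|U| * (54 * trunc_log 2 #|U| + 48).
  by apply: leq_mul => //; rewrite leq_add2r leq_mul2l.
(* Both [64 * 54] and [3 + 64 * 48] are below 3500. *)
apply: (@leq_trans (3 * #|U| + 64 * (#|U| * (54 * trunc_log 2 #|U| + 48)))).
  by rewrite leq_add2l leq_mul2l h.
clear; lia.
Qed.

End ThreeColours.

(** * Double counting *)

Lemma leq_card_fibres (T T' : finType) (f : T -> T') (A : {set T}) (B : {set T'}) m :
  (forall x, x \in A -> f x \in B) ->
  (forall y, y \in B -> #|[set x in A | f x == y]| <= m) -> #|A| <= #|B| * m.
Proof.
move=> fAB lem; rewrite -sum1_card (partition_big f (mem B)) //= -sum_nat_const.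
apply: leq_sum => y yB; apply: leq_trans (lem y yB); rewrite -sum1_card.
by rewrite (eq_bigl (fun x => x \in [set x in A | f x == y])) // => x; rewrite inE.
Qed.

Lemma card_pairs (T T' : finType) (A : {set T}) (B : {set T'}) (E : T -> T' -> bool) :
  #|[set p : T * T' | [&& p.1 \in A, p.2 \in B & E p.1 p.2]]| =
  \sum_(x in A) #|[set y in B | E x y]|.
Proof.
rewrite -sum1_card (partition_big fst (mem A)) /=; last by move=> p; rewrite inE => /and3P[].
apply: eq_bigr => x xA; rewrite -sum1_card.
rewrite (reindex_onto (fun y => (x, y)) snd) /=; last first.
  by move=> [a b] /= /andP[_ /eqP ->].
by apply: eq_bigl => y; rewrite !inE /= xA !eqxx !andbT.
Qed.

Lemma card_pairs_swap (T T' : finType) (A : {set T}) (B : {set T'}) (E : T -> T' -> bool) :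
  \sum_(x in A) #|[set y in B | E x y]| = \sum_(y in B) #|[set x in A | E x y]|.
Proof.
transitivity (\sum_(x in A) \sum_(y in B | E x y) 1).
  by apply: eq_bigr => x _; rewrite sum1dep_card.
rewrite (exchange_big_dep (mem B)) /=; last by move=> x y _ /andP[].
by apply: eq_bigr => y yB; rewrite sum1dep_card; apply: eq_card => x; rewrite !inE yB.
Qed.

Lemma leq_card_perm3 (V : finType) (F Q : {set V * V * V}) :
  (forall a b c, (a, b, c) \in F ->
     [|| (a, b, c) \in Q, (a, c, b) \in Q, (b, a, c) \in Q, (b, c, a) \in Q,
         (c, a, b) \in Q | (c, b, a) \in Q]) ->
  #|F| <= 6 * #|Q|.
Proof.
move=> FQ.
have inj_le (f : V * V * V -> V * V * V) : injective f -> #|f @^-1: Q| <= #|Q|.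
  by move=> injf; apply: (@leq_card_inj_in _ _ f) => [x y _ _ /injf|x]; rewrite ?inE.
pose f1 (t : V * V * V) := (t.1.1, t.1.2, t.2).
pose f2 (t : V * V * V) := (t.1.1, t.2, t.1.2).
pose f3 (t : V * V * V) := (t.1.2, t.1.1, t.2).
pose f4 (t : V * V * V) := (t.1.2, t.2, t.1.1).
pose f5 (t : V * V * V) := (t.2, t.1.1, t.1.2).
pose f6 (t : V * V * V) := (t.2, t.1.2, t.1.1).
have i1 : injective f1 by move=> [[a b] c] [[a' b'] c'] [-> -> ->].
have i2 : injective f2 by move=> [[a b] c] [[a' b'] c'] [-> -> ->].
have i3 : injective f3 by move=> [[a b] c] [[a' b'] c'] [-> -> ->].
have i4 : injective f4 by move=> [[a b] c] [[a' b'] c'] [-> -> ->].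
have i5 : injective f5 by move=> [[a b] c] [[a' b'] c'] [-> -> ->].
have i6 : injective f6 by move=> [[a b] c] [[a' b'] c'] [-> -> ->].
have cov : F \subset f1 @^-1: Q :|: (f2 @^-1: Q :|: (f3 @^-1: Q :|:
    (f4 @^-1: Q :|: (f5 @^-1: Q :|: f6 @^-1: Q)))).
  by apply/subsetP=> -[[a b] c] /FQ; rewrite !inE.
have := leq_card_cover2 cov (inj_le _ i1) (leq_card_cover2 (subxx _) (inj_le _ i2)
  (leq_card_cover2 (subxx _) (inj_le _ i3) (leq_card_cover2 (subxx _) (inj_le _ i4)
  (leq_card_cover2 (subxx _) (inj_le _ i5) (inj_le _ i6))))).
by move/leq_trans; apply; rewrite !mulSn mul0n addn0.
Qed.

Lemma ord3_cases (i j k l : 'I_3) : i != j -> i != k -> j != k ->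
  [|| l == i, l == j | l == k].
Proof.
by case: i => [[|[|[|]]] ?] //; case: j => [[|[|[|]]] ?] //;
   case: k => [[|[|[|]]] ?] //; case: l => [[|[|[|]]] ?].
Qed.

(** * Deleting part of a neighbourhood *)

Section Counting.

Variables (V : finType) (col : V -> V -> 'I_3).
Hypothesis colC : forall a b, col a b = col b a.
Local Notation rb := (rainbow3 col).
Hypothesis disj : forall a b c d, rb a b c -> rb a b d -> c = d.

(** [v] is left out because [col v v] has a value as well. *)
Definition nb v i (U : {set V}) := [set u in U | (u != v) && (col v u == i)].

Lemma nb_sub v i U : nb v i U \subset U.
Proof. by apply/subsetP=> u; rewrite inE => /andP[]. Qed.

Lemma nb_subset v i (A B : {set V}) : A \subset B -> #|nb v i A| <= #|nb v i B|.
Proof.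
move=> /subsetP sAB; apply/subset_leq_card/subsetP=> u; rewrite !inE.
by case/andP=> /sAB -> ->.
Qed.

Lemma leq_num_tri_cover (U A : {set V}) (B : {set V * V * V}) m :
  triples (tri col) U U U \subset triples (tri col) A A A :|: B -> #|B| <= m ->
  num_tri col U <= num_tri col A + m.
Proof. by move=> cov leB; exact: leq_card_cover2 cov (leqnn _) leB. Qed.

Lemma num_tri_le_sqr (U : {set V}) : num_tri col U <= #|U| * #|U|.
Proof.
rewrite -cardsX; apply: (@leq_card_inj_in _ _ fst) => [[p c] [p' c']|[p c]].
  rewrite !inE /= => /and4P[_ _ _ /tri_rainbow3 h] /and4P[_ _ _ /tri_rainbow3 h'] e.
  by subst p'; rewrite (disj h h').
by rewrite !inE => /and4P[-> -> _ _].
Qed.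

(* [S] consists of the blue neighbours of [v] with many green edges to the green
   neighbours; a red neighbour of [v] joined to [S] in blue (the set [Z]) inherits
   many green edges, so by the degree bound there are few of them. Triangles meeting
   [S] lie inside the blue neighbourhood, or cross the neighbourhoods of [v] inside
   the small set [U0], or contain a vertex outside [U0] (the set [Fx]); the last kind
   occurs at most twice for each vertex [w] in the middle, except for [w = v]. *)
Lemma removal_green (R B G : 'I_3) (U : {set V}) v D :
  R != B -> R != G -> B != G -> v \in U ->
  (forall u, u \in U -> #|nb u B U| <= D) ->
  (forall u, u \in U -> #|nb u G U| <= D) ->
  0 < #|nb v B U| -> 16 <= #|nb v G U| ->
  #|nb v B U| * #|nb v G U| <=
    2 * #|[set p : V * V | [&& p.1 \in nb v B U, p.2 \in nb v G U & col p.1 p.2 == G]]|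
    + #|nb v B U| ->
  exists S : {set V}, [/\ S \subset nb v B U, #|nb v B U| <= 8 * #|S| &
    num_tri col U <= num_tri col (U :\: S) +
      (num_tri col (nb v B U) + 42 * 1000 * (D * (trunc_log 2 #|U|).+1))].
Proof.
move=> nRB nRG nBG vU degB degG; set NB := nb v B U; set NG := nb v G U; set NR := nb v R U.
move=> b0 g16 green.
have nBR : B != R by rewrite eq_sym.
have nGR : G != R by rewrite eq_sym.
have nGB : G != B by rewrite eq_sym.
have col3 i : [|| i == R, i == B | i == G] by exact: ord3_cases.
have rbP a b c x y z : col a b = x -> col b c = y -> col a c = z ->
    x != y -> y != z -> x != z -> rb a b c.
  by rewrite /rainbow3 => -> -> -> -> -> ->.
pose gd x := #|[set y in NG | col x y == G]|.
pose S := [set x in NB | #|NG| <= 4 * gd x].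
have SNB : S \subset NB by apply/subsetP=> x; rewrite inE => /andP[].
(* Nearly half of the pairs are green, and vertices outside [S] account for at most a quarter of all
   pairs; [16 <= #|NG|] absorbs the error term. *)
have cS : #|NB| <= 8 * #|S|.
  rewrite (card_pairs NB NG (fun x y => col x y == G)) in green.
  have : 4 * \sum_(x in NB) gd x <= 4 * (#|S| * #|NG|) + #|NB| * #|NG|.
    have -> : #|S| * #|NG| = \sum_(x in NB) (if x \in S then #|NG| else 0).
      rewrite -big_mkcondr -sum_nat_const; apply: eq_bigl => x.
      by apply/idP/andP => [xS|[]//]; split=> //; exact: (subsetP SNB).
    rewrite -sum_nat_const !big_distrr -big_split /=; apply: leq_sum => x xNB.
    rewrite inE xNB /=; have gle : gd x <= #|NG|.
      by apply/subset_leq_card/subsetP=> y; rewrite inE => /andP[].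
    by move: gle; case: ifP => [_|/negbT]; rewrite -?ltnNge; clear; lia.
  move: green; rewrite -/(gd _); move: (\sum_(x in NB) gd x) #|NB| #|NG| #|S| g16 => e b g s.
  by clear; nia.
pose Z := [set z in NR | [exists x in S, col x z == B]].
have cZ : #|Z| <= 8 * D.
  (* Let [x z] be blue and [x y] green. If [z y] is red, then [x z y] is rainbow; if it is blue,
     then [v z y] is. So [z] misses at most two of the at least [|NG| / 4] green neighbours of [x]
     in [NG]. *)
  have gz z : z \in Z -> #|NG| <= 8 * gd z.
    rewrite inE => /andP[zR /existsP[x /andP[xS /eqP xz]]].
    have := xS; rewrite inE => /andP[xB gx].
    have cov : [set y in NG | col x y == G] \subset
        [set y in NG | col z y == G] :|: ([set y | rb x z y] :|: [set y | rb v z y]).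
      apply/subsetP=> y; rewrite inE => /andP[yG /eqP xy].
      have vy : col v y = G by move: yG; rewrite inE => /and3P[_ _ /eqP].
      have vz : col v z = R by move: zR; rewrite inE => /and3P[_ _ /eqP].
      have := col3 (col z y); rewrite in_setU in_setU inE yG /= !inE => /or3P[] /eqP zy.
      - by rewrite (rbP _ _ _ _ _ _ xz zy xy) ?orbT.
      - by rewrite (rbP _ _ _ _ _ _ vz zy vy) ?orbT.
      - by rewrite zy eqxx.
    have := leq_card_cover2 cov (leqnn _) (leq_card_cover2 (subxx _)
      (card_rainbow3_link disj x z) (card_rainbow3_link disj v z)).
    rewrite -/(gd x) -/(gd z); move: gx g16; clear; lia.
  have : \sum_(z in Z) gd z <= #|NG| * D.
    rewrite card_pairs_swap -sum_nat_const; apply: leq_sum => y yG.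
    have yU : y \in U by move: yG; rewrite inE => /andP[].
    apply: leq_trans (degG y yU); apply/subset_leq_card/subsetP=> z; rewrite !inE.
    case/andP=> /andP[/and3P[zU zv /eqP vz] _] /eqP zy; rewrite zU colC zy eqxx andbT /=.
    apply: contraNneq nRG => e; rewrite -vz e.
    by move: yG; rewrite inE => /and3P[_ _].
  have : #|Z| * #|NG| <= 8 * \sum_(z in Z) gd z.
    by rewrite -sum_nat_const big_distrr; exact: leq_sum.
  move: (\sum_(z in Z) gd z) #|Z| #|NG| g16 => e z g; clear; nia.
pose U0 := v |: (NB :|: (NG :|: Z)).
have bD := degB v vU; have gD := degG v vU.
have cU0 : #|U0| <= 11 * D.
  have h1 : #|[set v]| <= 1 by rewrite cards1.
  have := leq_card_cover2 (subxx U0) h1 (leq_card_cover2 (subxx _) bD (leq_card_cover2 (subxx _) gD cZ)).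
  move: b0 bD; rewrite -/NB; clear; lia.
have U0U : U0 \subset U.
  rewrite !subUset sub1set vU !nb_sub /=; apply/subsetP=> z; rewrite inE => /andP[+ _].
  exact: (subsetP (nb_sub _ _ _)).
pose Fx := triples rb S U0 (NR :\: Z).
have far z : z \in U -> z \notin U0 -> [/\ z \in NR, z \notin Z & z != v].
  move=> zU; rewrite !in_setU !negb_or in_set1 => /and4P[zv nB nG nZ]; split=> //.
  rewrite inE zU zv /=; have := col3 (col v z); case/or3P=> // h; exfalso.
    by case/negP: nB; rewrite inE zU zv.
  by case/negP: nG; rewrite inE zU zv.
(* In a rainbow triangle [x w z] with [x] in [S], [z] in [NR] outside [Z] and [w != v], the edge
   [x z] is red, and [pw w] and [qw w] are the colours of [x w] and [w z]. Other colours put [z] in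
   [Z] or create a rainbow triangle with [v] on an edge of [x w z]. *)
pose pw w := if col v w == B then G else B.
pose qw w := if col v w == B then B else G.
have inSb x : x \in S -> [/\ x \in U, x != v & col v x = B].
  by move/(subsetP SNB); rewrite inE => /and3P[? ? /eqP].
have facts x w z : x \in S -> z \in NR -> z \notin Z -> w != v -> rb x w z ->
    [/\ col x z = R, col x w = pw w & col w z = qw w].
  move=> xS zR zZ wv rxwz; have [xU xv vx] := inSb _ xS.
  have := zR; rewrite inE => /and3P[zU zv /eqP vz].
  have xzB : col x z != B.
    by apply: contra zZ => h; rewrite inE zR; apply/existsP; exists x; rewrite xS.
  have xzG : col x z != G.
    apply: contra wv => /eqP h; have r := rbP _ _ _ _ _ _ vx h vz nBG nGR nBR.
    apply/eqP; apply: (@disj x z); first by rewrite rainbow3_swapr.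
    by rewrite (rainbow3_swapr colC) (rainbow3_swapl colC).
  have xz : col x z = R.
    by have := col3 (col x z); rewrite (negbTE xzB) (negbTE xzG) !orbF => /eqP.
  have [n1 n2 n3] := and3P rxwz; rewrite xz in n2 n3.
  rewrite /pw /qw; have := col3 (col v w); case/or3P=> /eqP vw; rewrite vw.
  - rewrite (negbTE nRB); have xwG : col x w != G.
      apply: contra zv => /eqP h; have r := rbP _ _ _ _ _ _ vx h vw nBG nGR nBR.
      apply/eqP; apply: (@disj x w) => //.
      by rewrite (rainbow3_swapr colC) (rainbow3_swapl colC).
    have xw : col x w = B.
      by have := col3 (col x w); rewrite (negbTE n3) (negbTE xwG) orbF => /eqP.
    split=> //; have := col3 (col w z); rewrite (negbTE n2) -xw eq_sym (negbTE n1).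
    by move/eqP.
  - rewrite eqxx; have wzG : col w z != G.
      apply: contra xv => /eqP h; have r := rbP _ _ _ _ _ _ vw h vz nBG nGR nBR.
      by apply/eqP; exact: rainbow3_uniql rxwz r.
    have wz : col w z = B.
      by have := col3 (col w z); rewrite (negbTE n2) (negbTE wzG) orbF => /eqP.
    split=> //; have := col3 (col x w); rewrite (negbTE n3) -wz (negbTE n1).
    by move/eqP.
  - rewrite (negbTE nGB); have wzB : col w z != B.
      apply: contra xv => /eqP h; have r := rbP _ _ _ _ _ _ vw h vz nGB nBR nGR.
      by apply/eqP; exact: rainbow3_uniql rxwz r.
    have wz : col w z = G.
      by have := col3 (col w z); rewrite (negbTE n2) (negbTE wzB) => /eqP.
    rewrite wz in n1; split=> //; have := col3 (col x w).
    by rewrite (negbTE n3) (negbTE n1) orbF => /eqP.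
(* A vertex [w] outside [U0] is a red neighbour of [v], so [x w] would be blue and put [w] in
   [Z]. *)
have nearU x w z : x \in S -> w \in U -> z \in U -> z \notin U0 -> rb x w z -> w \in U0.
  move=> xS wU zU zU0 rxwz; apply/negPn/negP=> wU0.
  have [wR wZ wv] := far _ wU wU0; have [zR zZ _] := far _ zU zU0.
  have [_ xw _] := facts _ _ _ xS zR zZ wv rxwz.
  case/negP: wZ; rewrite inE wR; apply/existsP; exists x; rewrite xS xw /pw.
  by move: wR; rewrite inE => /and3P[_ _ /eqP ->]; rewrite (negbTE nRB) eqxx.
have cFx : #|Fx| <= D + #|U0| * 2.
  pose Fv := [set t in Fx | t.1.2 == v]; pose Fn := [set t in Fx | t.1.2 != v].
  have inFx t : t \in Fx ->
      [/\ t.1.1 \in S, t.1.2 \in U0, t.2 \in NR, t.2 \notin Z & rb t.1.1 t.1.2 t.2].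
    by rewrite inE in_setD => /and4P[? ? /andP[? ?] ?].
  have cov : Fx \subset Fv :|: Fn.
    by apply/subsetP=> t tF; rewrite !inE; move: tF; rewrite !inE => ->; case: eqP.
  apply: (leq_card_cover2 cov).
    apply: leq_trans bD; apply: (@leq_card_inj_in _ _ (fun t => t.1.1)).
      move=> [[x w] z] [[x' w'] z']; rewrite !(inE, in_setD) /= => /andP[+ /eqP ew] /andP[+ /eqP ew'] ex.
      subst=> /and4P[_ _ _ h] /and4P[_ _ _ h'].
      by rewrite (disj h h').
    by move=> t; rewrite inE => /andP[/inFx[/(subsetP SNB)]].
  apply: (@leq_card_fibres _ _ (fun t => t.1.2)) => [t|w wU0].
    by rewrite inE => /andP[/inFx[]].
  rewrite leqNgt; apply/negP=> /card_gt2P[[[x1 w1] z1] [[[x2 w2] z2] [[[x3 w3] z3] [[]]]]].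
  have inFn x w' z : (x, w', z) \in [set t in Fn | t.1.2 == w] ->
      [/\ w' = w, x \in S, z \in NR, z \notin Z & (w != v) && rb x w z].
    by rewrite inE => /andP[]; rewrite inE => /andP[/inFx /= [? ? ? ? ?] ?] /eqP <-; split=> //; apply/andP.
  move=> /inFn[? xS1 zR1 zZ1 /andP[wv r1]] /inFn[? xS2 zR2 zZ2 /andP[_ r2]].
  move=> /inFn[? xS3 zR3 zZ3 /andP[_ r3]] [n12 n23 n31]; subst w1 w2 w3.
  (* For distinct triples with the same [w], the edge [x z1] is not red, since then [x w z1] is
     rainbow and the triples agree, and not blue, since [z1] is outside [Z]. So it is green and
     [v x z1] is rainbow, which determines [x] and excludes a third triple. *)
  have key x z : x \in S -> rb x w z -> z \in NR -> z \notin Z -> (x, w, z) != (x1, w, z1) -> rb v x z1.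
    move=> xS rx zR zZ n; have [_ xv vx] := inSb _ xS.
    have [xz xw wz] := facts _ _ _ xS zR zZ wv rx.
    have [xz1 xw1 wz1] := facts _ _ _ xS1 zR1 zZ1 wv r1.
    have vz1 : col v z1 = R by move: zR1; rewrite inE => /and3P[_ _ /eqP].
    have := col3 (col x z1); case/or3P=> /eqP h.
    - case/negP: n; have r : rb x w z1.
        move: r1; rewrite /rainbow3 xz1 xw1 wz1 => /and3P[h1 h2 h3].
        by rewrite xw h h1 h2 h3.
      have ex := rainbow3_uniql colC disj r r1; subst x.
      by rewrite (disj rx r1).
    - by case/negP: zZ1; rewrite inE zR1; apply/existsP; exists x; rewrite xS h eqxx.
    - exact: (rbP _ _ _ _ _ _ vx h vz1).
  have k2 := key _ _ xS2 r2 zR2 zZ2; have k3 := key _ _ xS3 r3 zR3 zZ3.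
  rewrite eq_sym in n12; have e := rainbow3_uniqm colC disj (k2 n12) (k3 n31).
  by case/negP: n23; subst x3; rewrite (disj r2 r3).
pose L := (trunc_log 2 #|U|).+1.
have cX : #|cross_tri col v U0| <= 39 * 1000 * (D * L).
  apply: leq_trans (card_cross_tri colC disj v U0) _.
  have lL : (trunc_log 2 #|U0|).+1 <= L by rewrite ltnS; apply/leq_trunc_log/subset_leq_card.
  have := leq_mul cU0 lL; move: (#|U0| * _); clear; lia.
pose Ex := [set t in triples (tri col) U U U | [&& ~~ [&& t.1.1 \in U0, t.1.2 \in U0 & t.2 \in U0]
   & [|| t.1.1 \in S, t.1.2 \in S | t.2 \in S]]].
have cEx : #|Ex| <= 6 * #|Fx|.
  apply: leq_card_perm3 => a b c tE.
  have [aU bU cU rabc [far3 near3]] : [/\ a \in U, b \in U, c \in U, rb a b c &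
      [|| a \notin U0, b \notin U0 | c \notin U0] /\ [|| a \in S, b \in S | c \in S]].
    move: tE; rewrite inE inE /= => /andP[/and4P[aU bU cU /tri_rainbow3 rabc]].
    by rewrite !negb_and => /andP[].
  have SU0 x : x \in S -> x \in U0.
    by move=> xS; rewrite inE; apply/orP; right; rewrite inE (subsetP SNB).
  have inFx x w z : x \in S -> w \in U -> z \in U -> z \notin U0 -> rb x w z -> (x, w, z) \in Fx.
    move=> xS wU zU zU0 r; have [zR zZ _] := far _ zU zU0.
    by rewrite inE /= xS (nearU _ _ _ xS wU zU zU0 r) in_setD zR zZ.
  have rba : rb b a c by rewrite rainbow3_swapl.
  have rac : rb a c b by rewrite rainbow3_swapr.
  have rca : rb c a b by rewrite rainbow3_swapl.
  have rbc : rb b c a by rewrite rainbow3_swapr.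
  have rcb : rb c b a by rewrite rainbow3_swapl.
  have neg x : x \in S -> x \notin U0 -> false by move=> /SU0 ->.
  case/or3P: near3 => xS; case/or3P: far3 => zF; try by have := neg _ xS zF.
  - by rewrite (inFx _ _ _ xS cU bU zF rac) !orbT.
  - by rewrite (inFx _ _ _ xS bU cU zF rabc).
  - by rewrite (inFx _ _ _ xS cU aU zF rbc) !orbT.
  - by rewrite (inFx _ _ _ xS aU cU zF rba) !orbT.
  - by rewrite (inFx _ _ _ xS bU aU zF rcb) !orbT.
  - by rewrite (inFx _ _ _ xS aU bU zF rca) !orbT.
exists S; split=> //.
have cov : triples (tri col) U U U \subset triples (tri col) (U :\: S) (U :\: S) (U :\: S) :|:
    (triples (tri col) NB NB NB :|: (cross_tri col v U0 :|: Ex)).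
  apply/subsetP=> -[[a b] c] tU; have := tU; rewrite inE /= => /and4P[aU bU cU ht].
  case near: [|| a \in S, b \in S | c \in S]; last first.
    by rewrite in_setU inE /= !in_setD aU bU cU ht; move/negbT: near; rewrite !negb_or => /and3P[-> -> ->].
  rewrite in_setU; apply/orP; right; rewrite in_setU.
  case all0: [&& a \in U0, b \in U0 & c \in U0]; last first.
    by apply/orP; right; rewrite in_setU; apply/orP; right; rewrite inE tU /= all0 near.
  case cr: ((a, b, c) \in cross_tri col v U0).
    by apply/orP; right; rewrite in_setU cr.
  apply/orP; left; move: cr; rewrite inE inE /= ht.
  case/and3P: all0 => -> -> -> /= /negbFE /and4P[av bv cv]; rewrite negbK => /andP[/eqP kab /eqP kbc].
  have vB : col v b = B.
    by case/or3P: near => /inSb[_ _] // <-; [rewrite -kab|rewrite kbc].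
  by rewrite !inE /= aU bU cU av bv cv ht -kbc kab vB !eqxx.
(* In units of [D * L], crossing triangles cost at most 39000 and [Ex] at most [6 * 23]. *)
apply: (leq_num_tri_cover cov); apply: (leq_card_cover2 (subxx _)); first exact: leqnn.
have := leq_card_cover2 (subxx _) cX cEx; move/leq_trans; apply.
move: cFx cU0 (leq_addr (trunc_log 2 #|U| * D) D); rewrite -mulSn -/L [L * D]mulnC.
move: #|Fx| #|U0| (D * L); clear; lia.
Qed.

End Counting.

(** * Sparse colours and the majority colour *)

Section Phases.

Variables (V : finType) (col : V -> V -> 'I_3).
Hypothesis colC : forall a b, col a b = col b a.
Local Notation rb := (rainbow3 col).
Local Notation nb := (nb col).
Local Notation num_tri := (num_tri col).
Hypothesis disj : forall a b c d, rb a b c -> rb a b d -> c = d.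

(** A red pair between the blue and the green neighbourhood forms a rainbow triangle with [v], so
    the red pairs are a matching. Hence blue or green has nearly half of all pairs, and
    [removal_green] applies in one of the two assignments of roles. *)
Lemma removal (R B G : 'I_3) (U : {set V}) v D :
  R != B -> R != G -> B != G -> v \in U ->
  (forall u, u \in U -> #|nb u B U| <= D) ->
  (forall u, u \in U -> #|nb u G U| <= D) ->
  16 <= #|nb v B U| -> 16 <= #|nb v G U| ->
  exists i (S : {set V}), [/\ i \in [:: B; G], S \subset nb v i U,
    #|nb v i U| <= 8 * #|S| &
    num_tri U <= num_tri (U :\: S) +
      (num_tri (nb v i U) + 42 * 1000 * (D * (trunc_log 2 #|U|).+1))].
Proof.
move=> nRB nRG nBG vU degB degG b16 g16.
have nGB : G != B by rewrite eq_sym.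
pose e k := #|[set p : V * V | [&& p.1 \in nb v B U, p.2 \in nb v G U & col p.1 p.2 == k]]|.
have tot : #|nb v B U| * #|nb v G U| <= e B + (e G + e R).
  rewrite -cardsX; apply: (@leq_card_cover2 _ _
     [set p : V * V | [&& p.1 \in nb v B U, p.2 \in nb v G U & col p.1 p.2 == B]]
     ([set p : V * V | [&& p.1 \in nb v B U, p.2 \in nb v G U & col p.1 p.2 == G]]
     :|: [set p : V * V | [&& p.1 \in nb v B U, p.2 \in nb v G U & col p.1 p.2 == R]])).
  - apply/subsetP=> -[x y]; rewrite in_setX /= => /andP[xB yG].
    rewrite !in_setU !in_set /=; move: xB yG; rewrite !in_set => -> -> /=.
    by case/or3P: (ord3_cases (col x y) nRB nRG nBG) => ->; rewrite ?orbT.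
  - exact: leqnn.
  - by apply: (leq_card_cover2 (subxx _)); exact: leqnn.
have rbR x y : x \in nb v B U -> y \in nb v G U -> col x y = R -> rb v x y.
  rewrite !inE => /and3P[_ _ /eqP vx] /and3P[_ _ /eqP vy] xy.
  by rewrite /rainbow3 vx vy xy nRG nBG eq_sym nRB.
have eRB : e R <= #|nb v B U|.
  apply: (@leq_card_inj_in _ _ fst) => [[x y] [x' y']|[x y]]; last by rewrite inE => /and3P[].
  rewrite inE => /and3P[/= hx hy /eqP h]; rewrite inE => /and3P[/= hx' hy' /eqP h'] ex; subst x'.
  by rewrite (disj (rbR _ _ hx hy h) (rbR _ _ hx hy' h')).
have eRG : e R <= #|nb v G U|.
  apply: (@leq_card_inj_in _ _ snd) => [[x y] [x' y']|[x y]]; last by rewrite inE => /and3P[].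
  rewrite inE => /and3P[/= hx hy /eqP h]; rewrite inE => /and3P[/= hx' hy' /eqP h'] ex; subst y'.
  by rewrite (rainbow3_uniqm colC disj (rbR _ _ hx hy h) (rbR _ _ hx' hy h')).
have [le|lt] := leqP (e B) (e G).
  have [||S [h1 h2 h3]] := removal_green colC disj nRB nRG nBG vU degB degG _ g16.
  - exact: leq_trans b16.
  - move: tot eRB le; rewrite -/(e G); clear; lia.
  - by exists B, S; rewrite !inE eqxx.
have [||S [h1 h2 h3]] := removal_green colC disj nRG nRB nGB vU degG degB _ b16.
- exact: leq_trans g16.
- set e' := #|[set p : V * V | _]|; have : e B <= e'.
    apply: (@leq_card_inj_in _ _ (fun p => (p.2, p.1))) => [[x y] [x' y'] _ _ [-> ->] //|[x y]].
    by rewrite inE => /and3P[/= hx hy /eqP h]; rewrite inE /= hx hy colC h eqxx.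
  move: tot eRG lt; rewrite mulnC; clear; lia.
- by exists G, S; rewrite !inE eqxx orbT.
Qed.

Lemma other_colours (R : 'I_3) : exists B G : 'I_3, [/\ R != B, R != G & B != G].
Proof.
exists (ordS R), (ordS (ordS R)); rewrite !(eq_sym R).
by case: R => [[|[|[|]]]].
Qed.

(** Each triangle is counted at the vertex opposite to its edge of colour [R]. Of the more than [K]
    triangles at some vertex, any two have different [B]-neighbours and different [G]-neighbours
    there, by edge-disjointness. *)
Lemma exists_popular_vertex (R B G : 'I_3) (U : {set V}) K :
  R != B -> R != G -> B != G -> #|U| * K < num_tri U ->
  exists2 v, v \in U & (K <= #|nb v B U|) && (K <= #|nb v G U|).
Proof.
move=> nRB nRG nBG lt.
(* In the ordering of [tri], the entry at position [i] is opposite to the edge of colour [i]. *)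
pose opp (i : 'I_3) (t : V * V * V) := nth t.1.1 [:: t.1.1; t.1.2; t.2] i.
pose f t := (opp R t, opp G t, opp B t).
pose A := triples (fun x y z => [&& col y z == R, col x y == B & col x z == G]) U U U.
have cA : num_tri U <= #|A|.
  apply: (@leq_card_inj_in _ _ f) => [[[a b] c] [[a' b'] c'] _ _|[[a b] c]].
    rewrite /f /opp; move: nRB nRG nBG; clear.
    by case: R => [[|[|[|]]] ?] //; case: B => [[|[|[|]]] ?] //; case: G => [[|[|[|]]] ?] //= _ _ _ [-> -> ->].
  rewrite inE /= => /and4P[aU bU cU /and3P[h0 h1 h2]]; rewrite /f /opp inE /=.
  move: nRB nRG nBG h0 h1 h2; rewrite -!val_eqE; move: aU bU cU; clear -colC.
  move=> aU bU cU.
  by case: R => [[|[|[|]]] ?] //; case: B => [[|[|[|]]] ?] //; case: G => [[|[|[|]]] ?] //= _ _ _ h0 h1 h2;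
     rewrite aU bU cU /= ?(colC b a) ?(colC c a) ?(colC c b) h0 h1 h2.
have /existsP[v /andP[vU big]] :
    [exists v, (v \in U) && (K < #|[set t in A | t.1.1 == v]|)].
  apply: contraT; rewrite negb_exists => /forallP small.
  suff : #|A| <= #|U| * K by move: lt cA; clear; lia.
  apply: (@leq_card_fibres _ _ (fun t => t.1.1)) => [t|v vU].
    by rewrite inE => /and4P[].
  by have := small v; rewrite vU /= -leqNgt.
have inA t : t \in [set t in A | t.1.1 == v] -> [/\ t.1.1 = v, t.1.2 \in nb v B U,
    t.2 \in nb v G U & rb v t.1.2 t.2].
  rewrite inE => /andP[]; rewrite inE => /and4P[_ h2 h3 /and3P[/eqP h4 /eqP h5 /eqP h6]] /eqP ev.
  rewrite -ev; have r : rb t.1.1 t.1.2 t.2 by rewrite /rainbow3 h4 h5 h6 nRG nBG eq_sym nRB.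
  have [n1 n2 n3] := rainbow3_neq colC r.
  by rewrite !inE h2 h3 h5 h6 !eqxx r eq_sym n1 eq_sym n3.
exists v => //; apply/andP; split; apply: leq_trans (ltnW big) _.
  apply: (@leq_card_inj_in _ _ (fun t => t.1.2)) => [[[a b] c] [[a' b'] c']|t /inA[]//].
  by move=> /inA /= [-> _ _ r] /inA /= [-> _ _ r'] e; subst b'; rewrite (disj r r').
apply: (@leq_card_inj_in _ _ (fun t => t.2)) => [[[a b] c] [[a' b'] c']|t /inA[]//].
move=> /inA /= [-> _ _ r] /inA /= [-> _ _ r'] e; subst c'.
by rewrite (rainbow3_uniqm colC disj r r').
Qed.

(** While the bound fails, [removal] at a popular vertex deletes a nonempty set [S] at a cost of at
    most [|S| * K]. *)
Lemma num_tri_sparse (R : 'I_3) D K L (U : {set V}) :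
  (forall i u, i != R -> u \in U -> #|nb u i U| <= D) ->
  (forall N : {set V}, #|N| <= D -> 16 * num_tri N <= #|N| * K) ->
  trunc_log 2 #|U| < L -> 16 <= K -> 16 * (42 * 1000 * (D * L)) <= K * K ->
  num_tri U <= #|U| * K.
Proof.
move=> deg small; have [m] := ubnP #|U|; elim: m => // m IH in U deg *.
move=> /ltnSE leUm lL K16 big.
have [//|lt] := leqP (num_tri U) (#|U| * K).
have [B [G [nRB nRG nBG]]] := other_colours R.
have [v vU /andP[Kb Kg]] := exists_popular_vertex nRB nRG nBG lt.
have dB u : u \in U -> #|nb u B U| <= D by apply: deg; rewrite eq_sym.
have dG u : u \in U -> #|nb u G U| <= D by apply: deg; rewrite eq_sym.
have [i [S [iBG SN cN le]]] :=
  removal nRB nRG nBG vU dB dG (leq_trans K16 Kb) (leq_trans K16 Kg).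
have [KN ND] : K <= #|nb v i U| /\ #|nb v i U| <= D.
  by move: iBG; rewrite !inE => /orP[] /eqP ->; split; auto.
have SU : S \subset U := subset_trans SN (nb_sub _ _ _ _).
have cU : #|U| = #|S| + #|U :\: S| by rewrite -(cardsID S U) (setIidPr SU).
have S0 : 0 < #|S| by move: cN KN K16; clear; lia.
have leU := subset_leq_card (subsetDl U S).
have IHU : num_tri (U :\: S) <= #|U :\: S| * K.
  apply: IH => //; last 1 first.
  - apply: leq_ltn_trans lL; exact: leq_trunc_log.
  - move=> j u jR; rewrite inE => /andP[_ uU]; apply: leq_trans (deg j u jR uU).
    exact/nb_subset/subsetDl.
  - by move: cU S0 leUm; clear; lia.
have := small _ ND.
have c1 : 42 * 1000 * (D * (trunc_log 2 #|U|).+1) <= 42 * 1000 * (D * L).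
  by rewrite !leq_mul2l lL !orbT.
(* With [N] the chosen neighbourhood, [K <= |N| <= 8 |S|]. The triangles inside [N] cost at most
   [|N| K / 16] and the error term at most [K * K / 16], each at most [|S| K / 2]. *)
have h1 : K * K <= #|nb v i U| * K by rewrite leq_mul2r KN orbT.
have h2 : #|nb v i U| * K <= 8 * (#|S| * K) by rewrite mulnA leq_mul2r cN orbT.
move: lt; rewrite cU mulnDl; move: big le c1 IHU h1 h2; clear.
move: (42 * 1000 * _) (42 * 1000 * _) (K * K) (_ * K) (_ * K) (_ * K).
by move: (num_tri _) (num_tri _) (num_tri _); lia.
Qed.

Lemma sum_nb v (U : {set V}) : v \in U -> (\sum_i #|nb v i U|).+1 = #|U|.
Proof.
move=> vU; rewrite (cardsD1 v) vU add1n; congr S.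
rewrite -[RHS]sum1_card (partition_big (col v) predT) //=; apply: eq_bigr => i _.
by rewrite -sum1_card; apply: eq_bigl => u; rewrite !inE andbCA andbA.
Qed.

Lemma num_tri_split v (U : {set V}) : v \in U ->
  num_tri U <= \sum_i num_tri (nb v i U) + 35 * 100 * (#|U| * (trunc_log 2 #|U|).+1).
Proof.
move=> vU; pose B := \bigcup_(i : 'I_3) triples (tri col) (nb v i U) (nb v i U) (nb v i U).
have cB : #|B| <= \sum_i num_tri (nb v i U).
  by apply: (leq_card_bigcup (subxx _)) => i; exact: leqnn.
apply: leq_card_cover2 _ cB (card_cross_tri colC disj v U).
apply/subsetP=> -[[a b] c] tU; rewrite in_setU.
case cr: ((a, b, c) \in cross_tri col v U); first by rewrite orbT.
rewrite orbF; have := tU; rewrite inE /= => /and4P[aU bU cU ht].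
move: cr; rewrite inE tU /= => /negbFE /and4P[av bv cv]; rewrite negbK => /andP[/eqP kab /eqP kbc].
by apply/bigcupP; exists (col v a) => //; rewrite !inE /= aU bU cU av bv cv ht -kbc -kab !eqxx.
Qed.

(** [M i] collects the vertices whose large neighbourhood has colour [i], and [M R] has at least a
    third of [U]. Double counting the edges between the rest [P] and [M R] gives [|P| <= 4 D]. The
    two edges of a rainbow triangle at a vertex of [P] have different colours, so one of them lies
    among the at most [3 D] edges to small neighbourhoods; hence few triangles meet [P]. *)
Lemma num_tri_majority D (U : {set V}) : 0 < D -> 12 * D <= #|U| ->
  (forall v i j, v \in U -> i != j -> D <= #|nb v i U| -> #|nb v j U| < D) ->
  exists R (U' : {set V}), [/\ U' \subset U,
    forall i u, i != R -> u \in U' -> #|nb u i U'| <= D &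
    num_tri U <= num_tri U' + 72 * (D * D)].
Proof.
move=> D0 D12 unbal; pose M i := [set u in U | D <= #|nb u i U|].
have cov : U \subset \bigcup_i M i.
  apply/subsetP=> u uU; apply/bigcupP.
  have [i hi|no] := pickP (fun i => D <= #|nb u i U|); first by exists i; rewrite // inE uU.
  have := sum_nb uU; have : \sum_i #|nb u i U| <= \sum_(i < 3) D.
    by apply: leq_sum => i _; have := no i; clear; lia.
  rewrite sum_nat_const card_ord; move: D12 D0; clear; lia.
have [R hR] : exists R, #|U| <= 3 * #|M R|.
  apply/existsP; apply: contraT; rewrite negb_exists => /forallP small.
  have le1 := leq_card_bigcup cov (fun i => leqnn #|M i|).
  have : 3 * \sum_i #|M i| <= \sum_(i < 3) #|U|.-1.
    rewrite big_distrr; apply: leq_sum => i _; have := small i; rewrite -ltnNge /=.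
    by move: #|U| #|M i|; clear; lia.
  by rewrite sum_nat_const card_ord; move: le1 D12 D0; clear; lia.
exists R, (M R); pose P := U :\: M R.
have MU i : M i \subset U by apply/subsetP=> u; rewrite inE => /andP[].
have minor u i : u \in M R -> i != R -> #|nb u i U| < D.
  by rewrite inE => /andP[uU h] iR; apply: (unbal u R) => //; rewrite eq_sym.
split=> //.
  by move=> i u iR uM; apply: leq_trans (nb_subset _ _ _ (MU R)) (ltnW (minor _ _ uM iR)).
have cP : #|P| <= 4 * D.
  have le1 : #|P| * #|M R| <= \sum_(u in P) #|[set q in M R | col u q == R]| +
      \sum_(u in P) #|[set q in M R | col u q != R]|.
    rewrite -big_split -sum_nat_const; apply: leq_sum => u _ /=.
    rewrite -(cardsID [set q | col u q == R]); apply: leq_add; apply/subset_leq_card/subsetP=> q;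
    by rewrite !inE // => /andP[-> ->].
  have le2 : \sum_(u in P) #|[set q in M R | col u q == R]| <= #|P| * D.
    rewrite -sum_nat_const; apply: leq_sum => u; rewrite inE => /andP[nM uU].
    apply: (@leq_trans #|nb u R U|).
      apply/subset_leq_card/subsetP=> q; rewrite !inE => /andP[/andP[qU hq] uq].
      rewrite qU uq andbT; apply: contraNneq nM => e; by rewrite inE -e qU.
    by move: nM; rewrite inE uU /= -ltnNge => /ltnW.
  have le3 : \sum_(u in P) #|[set q in M R | col u q != R]| <= #|M R| * (2 * D).
    rewrite card_pairs_swap -sum_nat_const; apply: leq_sum => q qM.
    have [B [G [nRB nRG nBG]]] := other_colours R.
    have covq : [set u in P | col u q != R] \subset nb q B U :|: nb q G U.
      apply/subsetP=> u; rewrite !inE => /andP[/andP[nM uU] nR].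
      rewrite uU colC; have -> : u != q.
        by apply: contraNneq nM => ->; move: qM; rewrite inE.
      by have := ord3_cases (col u q) nRB nRG nBG; rewrite (negbTE nR) /=.
    have := leq_card_cover2 covq (ltnW (minor _ _ qM _)) (ltnW (minor _ _ qM _)).
    by rewrite mul2n -addnn; apply; rewrite eq_sym.
  move: le1 le2 le3 hR D12 D0.
  move: (\sum_(u in P) _) (\sum_(u in P) _) #|P| #|M R| #|U| => x y p m n; clear; nia.
pose Q := [set t in triples rb P U U | [exists i : 'I_3, (#|nb t.1.1 i U| < D) && (t.1.2 \in nb t.1.1 i U)]].
have cQ : #|Q| <= #|P| * (3 * D).
  apply: (@leq_card_fibres _ _ (fun t => t.1.1)) => [t|u uP].
    by rewrite inE => /andP[]; rewrite inE => /and4P[].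
  pose C i := if #|nb u i U| < D then nb u i U else set0.
  have cC : #|\bigcup_i C i| <= 3 * D.
    have -> : 3 * D = \sum_(i < 3) D by rewrite sum_nat_const card_ord.
    by apply: (leq_card_bigcup (subxx _)) => i; rewrite /C; case: ifP => [/ltnW|]; rewrite ?cards0.
  apply: leq_trans cC; apply: (@leq_card_inj_in _ _ (fun t => t.1.2)).
    move=> [[a b] c] [[a' b'] c']; rewrite !in_set /= => /andP[/andP[/and4P[_ _ _ r] _] /eqP ea].
    by move=> /andP[/andP[/and4P[_ _ _ r'] _] /eqP ea'] e; subst; rewrite (disj r r').
  move=> [[a b] c]; rewrite in_set in_set /= => /andP[/andP[_ /existsP[i /andP[h1 h2]]] /eqP e].
  by apply/bigcupP; exists i => //; rewrite /C -e h1.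
pose T := [set t in triples (tri col) U U U | [|| t.1.1 \in P, t.1.2 \in P | t.2 \in P]].
have cT : #|T| <= 6 * #|Q|.
  apply: leq_card_perm3 => a b c tT.
  have [aU bU cU rabc near] : [/\ a \in U, b \in U, c \in U, rb a b c &
      [|| a \in P, b \in P | c \in P]].
    by move: tT; rewrite inE inE /= => /andP[/and4P[aU bU cU /tri_rainbow3 rabc]].
  have inQ x y z : x \in P -> y \in U -> z \in U -> rb x y z ->
      ((x, y, z) \in Q) || ((x, z, y) \in Q).
    move=> xP yU zU r; have xU : x \in U by move: xP; rewrite inE => /andP[].
    have [n1 n2 n3] := rainbow3_neq colC r.
    have ncol : col x y != col x z by case/and3P: r.
    have r' : rb x z y by rewrite rainbow3_swapr.
    have [big|small] := leqP D #|nb x (col x y) U|.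
      apply/orP; right; rewrite inE inE /= xP zU yU r' /=; apply/existsP; exists (col x z).
      by rewrite (unbal x (col x y)) // inE zU eqxx eq_sym n3.
    apply/orP; left; rewrite inE inE /= xP zU yU r /=; apply/existsP; exists (col x y).
    by rewrite small inE yU eqxx eq_sym n1.
  have rba : rb b a c by rewrite rainbow3_swapl.
  have rca : rb c a b by rewrite rainbow3_swapl // rainbow3_swapr.
  case/or3P: near => xP.
  - by case/orP: (inQ _ _ _ xP bU cU rabc) => ->; rewrite ?orbT.
  - by case/orP: (inQ _ _ _ xP aU cU rba) => ->; rewrite ?orbT.
  - by case/orP: (inQ _ _ _ xP aU bU rca) => ->; rewrite ?orbT.
have covT : triples (tri col) U U U \subset triples (tri col) (M R) (M R) (M R) :|: T.
  apply/subsetP=> -[[a b] c] tU; rewrite in_setU.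
  case near: [|| a \in P, b \in P | c \in P].
    by apply/orP; right; rewrite inE tU /= near.
  apply/orP; left; move: tU near; rewrite inE /= => /and4P[aU bU cU ht].
  move/negbT; rewrite !negb_or !in_setD aU bU cU !andbT !negbK => /and3P[h1 h2 h3].
  by rewrite inE /= h1 h2 h3.
have cT' : #|T| <= 6 * (4 * D * (3 * D)).
  apply: leq_trans cT _; rewrite leq_mul2l /=; apply: leq_trans cQ _.
  by rewrite leq_mul2r cP orbT.
apply: leq_trans (leq_num_tri_cover covT cT') _.
by rewrite leq_add2l; clear; nia.
Qed.

End Phases.

(** * Reduction to three colours *)

Definition pair_col n (c : colouring n) (x y : 'I_n) := c [set x; y].

Lemma pair_colC n (c : colouring n) x y : pair_col c x y = pair_col c y x.
Proof. by rewrite /pair_col setUC. Qed.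

Lemma rainbowP n (c : colouring n) (T : {set 'I_n}) :
  reflect (exists t : 'I_n * 'I_n * 'I_n, T = [set t.1.1; t.1.2; t.2] /\
             rainbow3 (pair_col c) t.1.1 t.1.2 t.2) (rainbow c T).
Proof.
apply: (iffP andP) => [[_ /existsP[x /existsP[y /existsP[z /andP[/eqP -> h]]]]]|].
  by exists (x, y, z).
case=> [[[x y] z]] /= [-> r]; split; last first.
  by apply/existsP; exists x; apply/existsP; exists y; apply/existsP; exists z; rewrite eqxx.
have [nxy nyz nxz] := rainbow3_neq (@pair_colC n c) r.
by rewrite setUC cardsU1 cards2 nxy !inE negb_or (eq_sym z x) nxz (eq_sym z y) nyz.
Qed.

Lemma almost_gallai3_disjoint n (c : colouring n) : almost_gallai3 c ->
  forall x y z w, rainbow3 (pair_col c) x y z -> rainbow3 (pair_col c) x y w -> z = w.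
Proof.
move=> gal x y z w r r'; apply/eqP; apply: contraT => nzw.
have [nxy nyz nxz] := rainbow3_neq (@pair_colC n c) r.
have h1 : rainbow c [set x; y; z] by apply/rainbowP; exists (x, y, z).
have h2 : rainbow c [set x; y; w] by apply/rainbowP; exists (x, y, w).
have ne : [set x; y; z] != [set x; y; w].
  apply/eqP=> /setP /(_ z); rewrite !inE eqxx !orbT (negbTE nzw) orbF.
  by rewrite !(eq_sym z) (negbTE nxz) (negbTE nyz).
have := gal _ _ h1 h2 ne; rewrite ltnNge => /negP[].
have <- : #|[set x; y]| = 2 by rewrite cards2 nxy.
by apply/subset_leq_card; rewrite subsetI !subsetUl.
Qed.

Lemma disjoint_almost_gallai3 n (c : colouring n) :
  (forall x y z w, rainbow3 (pair_col c) x y z -> rainbow3 (pair_col c) x y w -> z = w) ->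
  almost_gallai3 c.
Proof.
move=> disj T1 T2 /rainbowP[[[x y] z] /= [-> r]] /rainbowP[[[x' y'] z'] /= [-> r']] ne.
have swl a b d : rainbow3 (pair_col c) a b d -> rainbow3 (pair_col c) b a d.
  by rewrite (rainbow3_swapl (@pair_colC n c)).
have swr a b d : rainbow3 (pair_col c) a b d -> rainbow3 (pair_col c) a d b.
  by rewrite (rainbow3_swapr (@pair_colC n c)).
have full a b d u v : rainbow3 (pair_col c) a b d -> u != v ->
    u \in [set a; b; d] -> v \in [set a; b; d] ->
    exists2 w, rainbow3 (pair_col c) u v w & [set a; b; d] = [set u; v; w].
  move=> rr nuv; rewrite !inE => /orP[/orP[]|] /eqP eu /orP[/orP[]|] /eqP ev; subst u v;
    try by rewrite eqxx in nuv.
  - by exists d.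
  - by exists b; [apply: swr|rewrite setUAC].
  - by exists d; [apply: swl|rewrite [[set b; a]]setUC].
  - by exists a; [apply/swr/swl|rewrite [[set b; d; a]]setUC setUA].
  - by exists b; [apply/swl/swr|rewrite [in RHS](setUC [set d]) setUAC].
  - by exists a; [apply/swl/swr/swl|rewrite [in RHS](setUC [set d]) [RHS]setUC setUA].
rewrite ltnNge; apply/negP=> /card_gt1P[u [v []]]; rewrite !in_setI => /andP[u1 u2] /andP[v1 v2] nuv.
have [w h1 e1] := full _ _ _ _ _ r nuv u1 v1; have [w' h2 e2] := full _ _ _ _ _ r' nuv u2 v2.
by case/negP: ne; rewrite e1 e2 (disj _ _ _ _ h1 h2).
Qed.

(* A random merging of the colours into three creates no rainbow triangle and keeps
   each one, correctly oriented, with probability at least 1/32. *)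
Lemma merge_colours n (c : colouring n) : exists mu : nat -> 'I_3,
  num_rainbow c <= 32 * num_tri (fun x y => mu (pair_col c x y)) [set: 'I_n].
Proof.
(* The colours are bounded by [M], so finitely many random bits suffice; [(a, false)] and
   [(a, true)] decide the new colour of [a]. *)
pose M := \max_(e : {set 'I_n}) c e.
pose k x y : 'I_M.+1 := inord (pair_col c x y).
have kinj x y z w : (k x y == k z w) = (pair_col c x y == pair_col c z w).
  apply/eqP/eqP=> [|e]; last by rewrite /k e.
  by move/(congr1 val); rewrite /= !inordK // ltnS; exact: (leq_bigmax_cond (F := c)).
pose sel (T : {set 'I_n}) := [pick t : 'I_n * 'I_n * 'I_n |
  (T == [set t.1.1; t.1.2; t.2]) && rainbow3 (pair_col c) t.1.1 t.1.2 t.2].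
have selP T : rainbow c T -> exists2 t, sel T = Some t &
    T = [set t.1.1; t.1.2; t.2] /\ rainbow3 (pair_col c) t.1.1 t.1.2 t.2.
  case/rainbowP=> t [eT r]; rewrite /sel; case: pickP => [t' /andP[/eqP e' r']|/(_ t)].
    by exists t'.
  by rewrite eT eqxx r.
(* Colour 0 needs the first bit in [H], colour 1 the first out and the second in, colour 2 both out:
   five bits for the three edges. *)
pose A (T : {set 'I_n}) := if sel T is Some t
  then [set (k t.1.2 t.2, false); (k t.1.1 t.2, true)] else set0.
pose B (T : {set 'I_n}) := if sel T is Some t
  then [set (k t.1.1 t.2, false); (k t.1.1 t.1.2, false); (k t.1.1 t.1.2, true)] else set0.
pose F := [set T | rainbow c T].
have [||H leF] := @exists_popular_set _ _ F A B 5.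
- move=> T; rewrite inE => /selP[t e [_ /and3P[h1 h2 h3]]].
  rewrite /A /B e; apply/pred0P=> -[i b] /=; rewrite !inE !xpair_eqE.
  apply/negP=> /andP[/orP[] /andP[/eqP -> /eqP ->]]; rewrite !kinj /= ?andbT ?andbF ?orbF.
    by rewrite (negbTE h2) /= eq_sym (negbTE h1).
  by rewrite eq_sym (negbTE h3).
- move=> T _; rewrite /A /B; case: (sel T) => [t|]; last by rewrite !cards0.
  have cA (p q : 'I_M.+1 * bool) : #|[set p; q]| <= 2 by rewrite cards2; case: (_ != _).
  have cB (p q r : 'I_M.+1 * bool) : #|[set p; q; r]| <= 2 + 1.
    by apply: (leq_card_cover2 (subxx _)); rewrite ?cA ?cards1.
  exact: leq_add (cA _ _) (cB _ _ _).
pose mu a : 'I_3 := if (inord a, false) \in H then inord 0 else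
  if (inord a, true) \in H then inord 1 else inord 2.
exists mu; apply: leq_trans leF _; rewrite leq_mul2l /=.
set G := [set T in F | _].
have inG T : T \in G -> exists2 t, sel T = Some t &
    [/\ T = [set t.1.1; t.1.2; t.2], A T \subset H & [disjoint B T & H]].
  rewrite inE => /andP[]; rewrite inE => /selP[t e [eT _]] /andP[h1 h2].
  by exists t.
have some_inj : injective (@Some ('I_n * 'I_n * 'I_n)) by move=> x y [].
rewrite /num_tri -(card_imset _ some_inj).
apply: (@leq_card_inj_in _ _ sel) => [T T' /inG[t e [eT _ _]] /inG[t' e' [eT' _ _]]|T].
  by rewrite e e' eT eT' => -[->].
move/inG=> [t e [_ hA hB]]; rewrite e; apply/imsetP; exists t => //.
move: hA hB; rewrite /A /B e => /subsetP hA hB; rewrite inE !in_setT /=.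
have a1 : (k t.1.2 t.2, false) \in H by apply: hA; rewrite !inE eqxx.
have a2 : (k t.1.1 t.2, true) \in H by apply: hA; rewrite !inE eqxx orbT.
have b1 : (k t.1.1 t.2, false) \in H = false.
  by apply: (disjointFr hB); rewrite !inE eqxx.
have b2 : (k t.1.1 t.1.2, false) \in H = false.
  by apply: (disjointFr hB); rewrite !inE eqxx !orbT.
have b3 : (k t.1.1 t.1.2, true) \in H = false.
  by apply: (disjointFr hB); rewrite !inE eqxx !orbT.
by rewrite /tri /mu -![inord (pair_col c _ _)]/(k _ _) a1 a2 b1 b2 b3 /= !inordK.
Qed.

(** * The hypercube colouring *)

Definition bit b k := odd (k %/ 2 ^ b).

Lemma bit_inj D k k' : k < 2 ^ D -> k' < 2 ^ D ->
  (forall b, b < D -> bit b k = bit b k') -> k = k'.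
Proof.
elim: D k k' => [|D IH] k k'; first by case: k => //; case: k'.
rewrite expnS => lt lt' eqb; have e0 : odd k = odd k'.
  by have := eqb 0 isT; rewrite /bit expn0 !divn1.
have eh : k %/ 2 = k' %/ 2.
  apply: IH; [by rewrite ltn_divLR // mulnC|by rewrite ltn_divLR // mulnC|move=> b bD].
  by have := eqb b.+1 bD; rewrite /bit expnS !divnMA.
by rewrite (divn_eq k 2) (divn_eq k' 2) eh !modn2 e0.
Qed.

Lemma bit_flip b u : bit b u = false -> bit b (u + 2 ^ b) = true.
Proof.
by rewrite /bit divnDr ?dvdnn // divnn expn_gt0 /= addn1 /= => ->.
Qed.

(** Since digit [b] of [u] is zero, adding [2 ^ b] produces no carry. *)
Lemma bit_flip_other b b' u : bit b u = false -> b' != b ->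
  bit b' (u + 2 ^ b) = bit b' u.
Proof.
rewrite /bit => e; rewrite neq_ltn => /orP[lt|lt].
  rewrite -(subnKC (ltnW lt)) expnD mulnC divnDMl ?expn_gt0 // oddD oddX.
  by rewrite subn_eq0 leqNgt lt addbF.
rewrite -(subnKC lt) expnD expnSr -mulnA !divnMA divnDr // divnn expn_gt0 /= addn1.
have -> : (u %/ 2 ^ b).+1 %/ 2 = u %/ 2 ^ b %/ 2 by rewrite !divn2 -uphalfE uphalf_half e.
by [].
Qed.

Section Hypercube.

Variables (n s : nat).
Hypothesis n_lt : n <= 2 ^ s.

(* The vertices below [s] are the coordinates of the cube; vertex [s + k] is the
   point of the cube with the binary digits of [k]. *)
Definition diff_bits k k' := [set b : 'I_s | bit b k != bit b k'].

(** [0] is red, [1] is blue and [2] is green. *)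
Definition cube_col (x y : 'I_n) : nat :=
  if x < s then if y < s then 0 else (bit x (y - s) : nat)
  else if y < s then (bit y (x - s) : nat)
  else if #|diff_bits (x - s) (y - s)| == 1 then 2 else 0.

Lemma cube_colC x y : cube_col x y = cube_col y x.
Proof.
rewrite /cube_col; do 2 case: ifP => //; move=> _ _.
have -> // : diff_bits (x - s) (y - s) = diff_bits (y - s) (x - s).
by apply/setP=> b; rewrite !inE eq_sym.
Qed.

Lemma cube_col_le2 x y : cube_col x y <= 2.
Proof.
rewrite /cube_col; case: (x < s); case: (y < s) => //; try by case: bit.
by case: (_ == 1).
Qed.

(** Edges are sets, so a representing pair is picked; by [cube_colC] its order does not matter. Sets
    without such a pair get [0]. *)
Definition cube_colouring : colouring n := fun e =>
  if [pick p : 'I_n * 'I_n | e == [set p.1; p.2]] is Some p then cube_col p.1 p.2 else 0.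

Lemma pair_col_cube x y : pair_col cube_colouring x y = cube_col x y.
Proof.
rewrite /pair_col /cube_colouring; case: pickP => [[a b] /= /eqP e|/(_ (x, y))]; last by rewrite eqxx.
have : x \in [set a; b] by rewrite -e !inE eqxx.
have : y \in [set a; b] by rewrite -e !inE eqxx orbT.
have : a \in [set x; y] by rewrite e !inE eqxx.
have : b \in [set x; y] by rewrite e !inE eqxx orbT.
rewrite !inE => /orP[] /eqP eb /orP[] /eqP ea; subst a b => hy hx //.
- by move: hy; rewrite orbb => /eqP ->.
- by rewrite cube_colC.
- by move: hx; rewrite orbb => /eqP ->.
Qed.

Local Notation rb := (rainbow3 cube_col).

Lemma cube_rainbow_no_labels (x y z : 'I_n) : x < s -> y < s -> rb x y z = false.
Proof.
move=> xs ys; rewrite /rainbow3 /cube_col xs ys.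
by case: (z < s) => //; case: bit; case: bit.
Qed.

Lemma cube_rainbow_edge (x y z : 'I_n) : rb x y z -> s <= x -> s <= y ->
  [/\ z < s, #|diff_bits (x - s) (y - s)| = 1 & bit z (x - s) != bit z (y - s)].
Proof.
move=> r xs ys; move: r; have xs' : (x < s) = false by rewrite ltnNge xs.
have ys' : (y < s) = false by rewrite ltnNge ys.
rewrite /rainbow3 /cube_col xs' ys'; case: (ltnP z s) => zs /=; last by do 3 case: (_ == 1).
by case: (_ =P 1) => //; do 2 case: bit.
Qed.

(** A rainbow triangle consists of the ends of a cube edge and its direction. Two points determine
    the direction, and a point with a direction determines the other point. *)
Lemma cube_disjoint x y z w : rb x y z -> rb x y w -> z = w.
Proof.
have swl := rainbow3_swapl cube_colC; have swr := rainbow3_swapr cube_colC.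
have label_case a b c e : rb a b c -> rb a b e -> a < s -> s <= b -> c = e.
  move=> r r' as_ bs.
  have cs : s <= c by rewrite leqNgt; apply/negP=> cs; rewrite swr cube_rainbow_no_labels in r.
  have es : s <= e by rewrite leqNgt; apply/negP=> es; rewrite swr cube_rainbow_no_labels in r'.
  rewrite swl swr in r; rewrite swl swr in r'.
  have [_ /eqP/cards1P[p1 e1] n1] := cube_rainbow_edge r bs cs.
  have [_ /eqP/cards1P[p2 e2] n2] := cube_rainbow_edge r' bs es.
  (* By [n <= 2 ^ s] a point is determined by its [s] digits, and [c] and [e] both differ from [b]
     exactly in digit [a]. *)
  apply: val_inj; suff : c - s = e - s by move=> h; rewrite /= -(subnK cs) h subnK.
  apply: (@bit_inj s); [apply: leq_ltn_trans (leq_subr _ _) (leq_trans (ltn_ord _) n_lt)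
    |apply: leq_ltn_trans (leq_subr _ _) (leq_trans (ltn_ord _) n_lt)|move=> k ks].
  pose a' := Ordinal as_; pose k' := Ordinal ks.
  have a1 : a' = p1 by apply/set1P; rewrite -e1 inE.
  have a2 : a' = p2 by apply/set1P; rewrite -e2 inE.
  have := in_set1 k' p1; have := in_set1 k' p2; rewrite -e1 -e2 !inE -a1 -a2 /= => h2 h1.
  move: h1; rewrite -h2; by case: (bit k (b - s)); case: (bit k (c - s)); case: (bit k (e - s)).
move=> r r'; case: (ltnP x s) => xs; case: (ltnP y s) => ys.
- by rewrite cube_rainbow_no_labels in r.
- exact: label_case r r' xs ys.
- by rewrite swl in r; rewrite swl in r'; exact: label_case r r' ys xs.
have [zs /eqP/cards1P[p e] nz] := cube_rainbow_edge r xs ys.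
have [ws _ nw] := cube_rainbow_edge r' xs ys.
have ez : Ordinal zs = p by apply/set1P; rewrite -e inE.
have ew : Ordinal ws = p by apply/set1P; rewrite -e inE.
by apply: val_inj; have := congr1 val (etrans ez (esym ew)).
Qed.

Lemma cube_almost_gallai3 : almost_gallai3 cube_colouring.
Proof.
apply: disjoint_almost_gallai3 => x y z w; rewrite /rainbow3 !pair_col_cube.
exact: cube_disjoint.
Qed.

Lemma cube_uses_three_colours : uses_three_colours cube_colouring.
Proof.
exists 0, 1, 2 => x y _; rewrite -/(pair_col _ x y) pair_col_cube.
by move: (cube_col_le2 x y); rewrite !inE; case: cube_col => [|[|[|]]].
Qed.

(** The pair of [b] and [u] stands for the cube edge from [u] to [u + 2 ^ b] in direction [b], with
    digit [b] zero at the lower end. *)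
Definition cube_edges := [set p : 'I_n * 'I_n | [&& p.1 < s, s <= p.2,
  ~~ bit p.1 (p.2 - s) & p.2 + 2 ^ p.1 < n]].

Lemma card_cube_edges_le : #|cube_edges| <= num_rainbow cube_colouring.
Proof.
pose up (p : 'I_n * 'I_n) : 'I_n := insubd p.2 (p.2 + 2 ^ p.1).
have upE p : p \in cube_edges -> up p = p.2 + 2 ^ p.1 :> nat.
  by rewrite inE => /and4P[_ _ _ lt]; rewrite /up val_insubd lt.
pose f p := [set p.1; p.2; up p].
have inE4 p : p \in cube_edges -> [/\ p.1 < s, s <= p.2, bit p.1 (p.2 - s) = false &
    s <= up p /\ up p - s = (p.2 - s) + 2 ^ p.1].
  move=> pE; have := pE; rewrite inE => /and4P[h1 h2 /negbTE h3 _]; rewrite (upE _ pE).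
  by split=> //; split; [exact: leq_trans h2 (leq_addr _ _)|rewrite addnBAC].
apply: (@leq_card_inj_in _ _ f) => [p q pE qE e|p pE].
  have [p1 p2 p3 [p4 p5]] := inE4 _ pE; have [q1 q2 q3 [q4 q5]] := inE4 _ qE.
  have e1 : p.1 = q.1.
    have : p.1 \in f q by rewrite -e !inE eqxx.
    by rewrite !inE => /orP[/orP[]|] /eqP // h; [move: q2|move: q4]; rewrite -h leqNgt p1.
  have e2 : p.2 = q.2.
    have : p.2 \in f q by rewrite -e !inE eqxx orbT.
    rewrite !inE => /orP[/orP[]|] /eqP // h; first by move: p2; rewrite h leqNgt q1.
    by move: p3; rewrite h q5 e1 bit_flip.
  by case: p q {pE qE e p1 p2 p3 p4 p5 q1 q2 q3 q4 q5} e1 e2 => [? ?] [? ?] /= -> ->.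
have [p1 p2 p3 [p4 p5]] := inE4 _ pE.
rewrite inE; apply/rainbowP; exists (p.1, p.2, up p); split=> //=.
rewrite /rainbow3 !pair_col_cube /cube_col p1 (ltnNge p.2) (ltnNge (up p)) p2 p4 /= p5 p3 bit_flip //.
have -> : #|diff_bits (p.2 - s) (p.2 - s + 2 ^ p.1)| = 1; last by [].
apply/eqP/cards1P; exists (Ordinal p1); apply/setP=> b; rewrite !inE.
have [->|nb] := eqVneq b (Ordinal p1); first by rewrite /= p3 bit_flip.
by rewrite bit_flip_other ?eqxx //; apply: contra nb => /eqP h; apply/eqP/val_inj.
Qed.

(** Each complete block of [2 ^ b.+1] consecutive points contributes its first half as lower ends;
    at most one block is incomplete. *)
Lemma card_cube_edges_bit (b : 'I_n) : b < s ->
  n - s - 2 ^ b.+1 <= 2 * #|[set u : 'I_n | (b, u) \in cube_edges]|.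
Proof.
move=> bd; pose m := (n - s) %/ 2 ^ b.+1.
have p0 : 0 < 2 ^ b by rewrite expn_gt0.
have lem : m * 2 ^ b <= #|[set u : 'I_n | (b, u) \in cube_edges]|.
  have -> : m * 2 ^ b = #|[set: 'I_m * 'I_(2 ^ b)]| by rewrite cardsT card_prod !card_ord.
  pose f (p : 'I_m * 'I_(2 ^ b)) : 'I_n := insubd b (s + (p.1 * 2 ^ b.+1 + p.2)).
  have lt (p : 'I_m * 'I_(2 ^ b)) : s + (p.1 * 2 ^ b.+1 + p.2) + 2 ^ b < n.
    have h1 := leq_trunc_div (n - s) (2 ^ b.+1); rewrite -/m in h1.
    have h2 : p.1.+1 * 2 ^ b.+1 <= m * 2 ^ b.+1 by rewrite leq_mul2r ltn_ord orbT.
    move: h1 h2 (ltn_ord p.2) p0; rewrite mulSn expnS.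
    move: (nat_of_ord p.1) (nat_of_ord p.2) => a r; move: (2 ^ b) => B.
    by move: (m * _) (a * _); clear; lia.
  have fE p : f p = s + (p.1 * 2 ^ b.+1 + p.2) :> nat.
    by rewrite /f val_insubd (leq_ltn_trans (leq_addr _ _) (lt p)).
  have q1 (p : 'I_m * 'I_(2 ^ b)) : (p.1 * 2 ^ b.+1 + p.2) %/ 2 ^ b = p.1 * 2.
    by rewrite expnS mulnA divnMDl // divn_small ?addn0.
  have q2 (p : 'I_m * 'I_(2 ^ b)) : (p.1 * 2 ^ b.+1 + p.2) %% 2 ^ b = p.2.
    by rewrite expnS mulnA modnMDl modn_small.
  apply: (@leq_card_inj_in _ _ f) => [p p' _ _ /(congr1 val)|p _].
    rewrite /= !fE => /addnI e; have := q1 p; have := q2 p; rewrite e q1 q2 => e2 e1.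
    case: p p' e1 e2 {e} => [p1 p2] [p1' p2'] /= e1 e2; congr pair; apply: val_inj => //=.
    by apply/eqP; rewrite -(eqn_pmul2r (isT : 0 < 2)); apply/eqP.
  rewrite !inE /= bd fE leq_addr addKn lt andbT /= /bit q1.
  by rewrite muln2 odd_double.
have := ltn_ceil (n - s) (_ : 0 < 2 ^ b.+1); rewrite -/m expn_gt0 => /(_ isT).
move: lem; rewrite expnS mulSn; move: #|_| => e.
have -> : m * (2 * 2 ^ b) = 2 * (m * 2 ^ b) by rewrite mulnCA.
move: (m * 2 ^ b) (2 ^ b) (n - s) => X Y Z; clear; lia.
Qed.

(** Over all directions, the incomplete blocks lose a geometric sum. *)
Lemma num_rainbow_cube : s <= n ->
  s * (n - s) <= 2 * num_rainbow cube_colouring + 2 ^ s.+1.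
Proof.
move=> sn. have le1 : \sum_(b < s) (n - s - 2 ^ b.+1) <= 2 * #|cube_edges|.
  have -> : #|cube_edges| = \sum_(b : 'I_n | b < s) #|[set u : 'I_n | (b, u) \in cube_edges]|.
    rewrite -sum1_card (partition_big fst (fun b : 'I_n => b < s)) /=; last first.
      by move=> p; rewrite inE => /and4P[].
    apply: eq_bigr => b bd; rewrite -sum1_card.
    rewrite (reindex_onto (fun u => (b, u)) snd) /=; last by move=> [x y] /= /andP[_ /eqP ->].
    by apply: eq_bigl => u; rewrite !inE /= !eqxx !andbT.
  rewrite (big_ord_widen _ (fun b => n - s - 2 ^ b.+1) sn) big_distrr /=.
  by apply: leq_sum => b bd; exact: card_cube_edges_bit.
have le2 : s * (n - s) <= \sum_(b < s) (n - s - 2 ^ b.+1) + \sum_(b < s) 2 ^ b.+1.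
  rewrite -big_split -{1}(card_ord s) -sum_nat_const; apply: leq_sum => b _ /=.
  by rewrite addnC -leq_subLR.
have le3 : \sum_(b < s) 2 ^ b.+1 <= 2 ^ s.+1.
  elim: (s) => [|k IH]; first by rewrite big_ord0.
  by rewrite big_ord_recr /= [X in _ <= X]expnS mul2n -addnn leq_add2r.
move: le1 le2 le3 card_cube_edges_le; clear; lia.
Qed.

End Hypercube.

(** With [s = d + 1] the points fit in the cube. Setting aside [s] coordinates costs
    [s ^ 2 <= 4 * 2 ^ d] and the incomplete blocks cost [4 * 2 ^ d], together at most [8 n]. *)
Lemma num_rainbow_cube_log n : 1 < n ->
  exists2 c : colouring n, almost_gallai3 c /\ uses_three_colours c &
    trunc_log 2 n * n <= 2 * num_rainbow c + 8 * n.
Proof.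
move=> n1; pose d := trunc_log 2 n.
have nlt : n <= 2 ^ d.+1 by apply/ltnW/trunc_log_ltn.
have dn : 2 ^ d <= n by apply: trunc_logP => //; exact: ltnW.
exists (@cube_colouring n d.+1).
  by split; [exact: cube_almost_gallai3|exact: cube_uses_three_colours].
have dle : d.+1 <= n by apply: leq_trans dn; exact: ltn_expl.
have := num_rainbow_cube dle; rewrite -/d.
have sq : d.+1 * d.+1 <= 4 * 2 ^ d.
  have h k : k.+1 + k.+2 <= 4 * 2 ^ k /\ k.+1 * k.+1 <= 4 * 2 ^ k.
    by elim: k => [|k [IH1 IH2]] //; rewrite expnS; move: (2 ^ k) IH1 IH2; clear; nia.
  by case: (h d).
have : d.+1 * n <= d.+1 * (n - d.+1) + d.+1 * d.+1.
  by rewrite -mulnDr leq_mul2l; apply/orP; right; clear; lia.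
move: sq dn; rewrite [2 ^ d.+2]expnS [2 ^ d.+1]expnS [d.+1 * n]mulSn.
move: (d.+1 * d.+1) (d * n) (d.+1 * (_ - _)) (2 ^ d) (num_rainbow _); clear; lia.
Qed.

(** * Asymptotics *)

Local Open Scope R_scope.

Lemma leq_INR m n : (m <= n)%N -> INR m <= INR n.
Proof. by move/leP; exact: le_INR. Qed.

Lemma INR_leq m n : INR m <= INR n -> (m <= n)%N.
Proof. by move/INR_le/leP. Qed.

Lemma INR_addn m n : INR (m + n)%N = INR m + INR n.
Proof. exact: plus_INR. Qed.

Lemma INR_muln m n : INR (m * n)%N = INR m * INR n.
Proof. exact: mult_INR. Qed.

Lemma INR_expn m k : INR (m ^ k)%N = INR m ^ k.
Proof. by elim: k => [|k IH] //=; rewrite expnS INR_muln IH. Qed.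

Lemma exists_nat_ceil x : 0 <= x -> exists D : nat, x <= INR D <= x + 1.
Proof.
move=> x0; have [h1 h2] := archimed x; exists (Z.to_nat (up x)).
have u0 : (0 <= up x)%Z by apply: le_IZR; lra.
by rewrite INR_IZR_INZ Znat.Z2Nat.id //; lra.
Qed.

(* About n ^ 0.379: the recursion closes for every exponent above 1/3, and the
   theorem allows sqrt 2 - 1. *)
Definition growth (n : nat) : R := (13 / 10) ^ trunc_log 2 n.

Lemma growth_ge1 n : 1 <= growth n.
Proof. by apply: pow_R1_Rle; lra. Qed.

Lemma growth_shift k m n : (0 < m)%N -> (2 ^ k * m <= n)%N ->
  (13 / 10) ^ k * growth m <= growth n.
Proof.
move=> m0 le; rewrite /growth -pow_add; apply: Rle_pow; first lra.
apply/leP; apply: trunc_log_max => //; apply: leq_trans le.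
by rewrite -[(k + _)%coq_nat]/(k + _)%N expnD leq_mul2l trunc_logP // orbT.
Qed.

Lemma growth_le m n : (m <= n)%N -> growth m <= growth n.
Proof.
move=> le; apply: Rle_pow; first lra.
by apply/leP; exact: leq_trunc_log.
Qed.

(** The base [2197 / 2000] is half the cube of [13 / 10]: it serves to compare the cube of [growth]
    with the size times a squared logarithm. The case 128 is checked by repeated squaring. *)
Lemma poly_le_exp L : (128 <= L)%N ->
  2 * (INR L + 1) ^ 2 <= (2197 / 2000) ^ L /\ 131072 * (INR L + 1) <= (13 / 10) ^ L.
Proof.
move=> /subnKC <-; elim: (L - 128)%N => [|k IH].
  rewrite addn0 [INR 128]INR_IZR_INZ /=; set x := 2197 / 2000; set y := 13 / 10.
  have sq a b c k : 0 <= b -> b <= a ^ k -> c <= b * b -> c <= a ^ (k + k).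
    by move=> b0 ba cb; rewrite pow_add; nra.
  split.
    have x2 : 12/10 <= x ^ (1 + 1) by apply: (@sq x x) => //=; rewrite /x; lra.
    have x4 : 144/100 <= x ^ (2 + 2) by apply: (@sq x (12/10)) => //; lra.
    have x8 : 207/100 <= x ^ (4 + 4) by apply: (@sq x (144/100)) => //; lra.
    have x16 : 428/100 <= x ^ (8 + 8) by apply: (@sq x (207/100)) => //; lra.
    have x32 : 183/10 <= x ^ (16 + 16) by apply: (@sq x (428/100)) => //; lra.
    have x64 : 334 <= x ^ (32 + 32) by apply: (@sq x (183/10)) => //; lra.
    have x128 : 111000 <= x ^ (64 + 64) by apply: (@sq x 334) => //; lra.
    apply: Rle_trans x128; lra.
  have x2 : 169/100 <= y ^ (1 + 1) by apply: (@sq y y) => //=; rewrite /y; lra.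
  have x4 : 28/10 <= y ^ (2 + 2) by apply: (@sq y (169/100)) => //; lra.
  have x8 : 7 <= y ^ (4 + 4) by apply: (@sq y (28/10)) => //; lra.
  have x16 : 49 <= y ^ (8 + 8) by apply: (@sq y 7) => //; lra.
  have x32 : 2401 <= y ^ (16 + 16) by apply: (@sq y 49) => //; lra.
  have x64 : 5000000 <= y ^ (32 + 32) by apply: (@sq y 2401) => //; lra.
  have x128 : 25000000000000 <= y ^ (64 + 64) by apply: (@sq y 5000000) => //; lra.
  apply: Rle_trans x128; lra.
have l128 : 128 <= INR (128 + k).
  have -> : 128 = INR 128 by rewrite [RHS]INR_IZR_INZ.
  exact/leq_INR/leq_addr.
rewrite addnS S_INR; move: (128 + k)%N IH l128 => l [IH1 IH2] l128.
have : (INR l + 1 + 1) ^ 2 <= 2197 / 2000 * (INR l + 1) ^ 2 by rewrite /=; nra.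
have powS x : x ^ l.+1 = x * x ^ l by [].
by rewrite !powS; split; lra.
Qed.

(** Used for the neighbourhoods of a vertex, one of which, [k], is small enough for a better
    constant [c']. *)
Lemma sum_gain (I : finType) (k : I) (f g : I -> nat) c c' : 0 <= c ->
  (forall i, INR (f i) <= c * INR (g i)) -> INR (f k) <= c' * INR (g k) ->
  INR (\sum_i f i) <= c * INR (\sum_i g i) - (c - c') * INR (g k).
Proof.
move=> c0 fg fgk; rewrite [\sum_i f i](bigD1 k) // [\sum_i g i](bigD1 k) //= !INR_addn.
have : INR (\sum_(i | i != k) f i) <= c * INR (\sum_(i | i != k) g i).
  apply: (big_ind2 (fun x y => INR x <= c * INR y)) => //.
  - by rewrite /=; lra.
  - by move=> x x' y y' h h'; rewrite !INR_addn; lra.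
lra.
Qed.

(** * The recursion for the number of triangles *)

Section Recursion.

Variables (V : finType) (col : V -> V -> 'I_3).
Hypothesis colC : forall a b, col a b = col b a.
Hypothesis disj : forall a b c d,
  rainbow3 col a b c -> rainbow3 col a b d -> c = d.
Variable A : R.
Hypotheses (A_ge : 2 ^ 129 <= A) (A_big : 100000 <= A).

Local Notation bound N := (A * INR #|pred_of_set N| * growth #|pred_of_set N|).

Variable U : {set V}.
Hypothesis IH : forall N : {set V}, (#|N| < #|U|)%N ->
  INR (num_tri col N) <= bound N.

Let n := INR #|U|.
Let l := INR (trunc_log 2 #|U|) + 1.
Let h := growth #|U|.

Hypothesis U_big : A < n.

Lemma trunc_log_ge128 : (128 <= trunc_log 2 #|U|)%N.
Proof.
apply: trunc_log_max => //; apply: INR_leq; rewrite INR_expn.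
apply: Rle_trans (Rlt_le _ _ U_big); apply: Rle_trans A_ge.
have -> : INR 2 = 2 by [].
by apply: Rle_pow; [lra|apply/leP].
Qed.

(** [h ^ 3] is [2 ^ trunc_log 2 #|U|], at least half of [n], times an exponential that is at least
    [2 l ^ 2]. Here the exponent must exceed 1/3. *)
Lemma recursion_numbers :
  [/\ 129 <= l, 131072 * l <= h, n * l ^ 2 <= h ^ 3, h <= n & 0 < h].
Proof.
have L128 := trunc_log_ge128; have [le1 le2] := poly_le_exp L128.
have U0 : (0 < #|U|)%N by rewrite lt0n; apply: contraTneq L128 => ->; rewrite trunc_log0.
have l129 : 129 <= l.
  have := leq_INR L128; rewrite (_ : INR 128 = 128); last by rewrite [LHS]INR_IZR_INZ.
  rewrite /l; lra.
have h0 : 0 < h by have := growth_ge1 #|U|; rewrite -/h; lra.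
have lt : n <= 2 * 2 ^ trunc_log 2 #|U|.
  have -> : 2 * 2 ^ trunc_log 2 #|U| = INR (2 ^ (trunc_log 2 #|U|).+1)%N.
    by rewrite INR_expn.
  exact/leq_INR/ltnW/trunc_log_ltn.
have hn : h <= n.
  apply: (@Rle_trans _ (2 ^ trunc_log 2 #|U|)).
    by apply: pow_incr; lra.
  have -> : 2 ^ trunc_log 2 #|U| = INR (2 ^ trunc_log 2 #|U|)%N by rewrite INR_expn.
  exact/leq_INR/trunc_logP.
split=> //.
have -> : h ^ 3 = (2197 / 2000) ^ trunc_log 2 #|U| * 2 ^ trunc_log 2 #|U|.
  rewrite /h /growth -Rpow_mult_distr -pow_mult Nat.mul_comm pow_mult.
  by congr (_ ^ _); lra.
have p0 : 0 < 2 ^ trunc_log 2 #|U| by apply: pow_lt; lra.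
have : n * l ^ 2 <= 2 * 2 ^ trunc_log 2 #|U| * l ^ 2.
  by apply: Rmult_le_compat_r => //; apply: pow2_ge_0.
move: le1; rewrite -/l; move: (2 ^ trunc_log 2 #|U|) p0 ((2197 / 2000) ^ _) => P P0 X; nra.
Qed.

(** Neighbourhood [k] has at most half of the vertices, so its bound improves by the factor
    [10 / 13]. It has at least [n l / h] vertices, so the gain is at least [3 A n l / 13], more than
    the [3500 n l] for crossing triangles. *)
Lemma recursion_split v D k : v \in U -> n * l <= INR D * h -> (D <= #|nb col v k U|)%N ->
  (2 * #|nb col v k U| <= #|U|)%N -> INR (num_tri col U) <= bound U.
Proof.
move=> vU hD Dk k2; have [l129 _ _ hn h0] := recursion_numbers.
have n0 : 0 < n by lra.
have := leq_INR (num_tri_split colC disj vU); rewrite INR_addn !INR_muln (S_INR (trunc_log 2 #|U|)) -/l -/n.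
have nbU i : (#|nb col v i U| < #|U|)%N.
  apply: proper_card; apply/properP; split; first exact: nb_sub.
  by exists v => //; rewrite !inE eqxx andbF.
have f1 i : INR (num_tri col (nb col v i U)) <= A * h * INR #|nb col v i U|.
  apply: Rle_trans (IH (nbU i)) _; have := growth_le (ltnW (nbU i)).
  have := pos_INR #|nb col v i U|; rewrite -/h; move: (INR #|_|) (growth _) => x g x0 gh.
  have : x * g <= x * h by apply: Rmult_le_compat_l.
  nra.
have f2 : INR (num_tri col (nb col v k U)) <= A * h * (10 / 13) * INR #|nb col v k U|.
  apply: Rle_trans (IH (nbU k)) _.
  have [->|m0] := posnP #|nb col v k U|; first by rewrite /=; lra.
  have := @growth_shift 1 _ _ m0 k2; have := pos_INR #|nb col v k U|.
  rewrite pow_1 -/h; move: (INR #|_|) (growth _) => x g x0 gh.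
  have : x * g <= x * (10 / 13 * h) by apply: Rmult_le_compat_l => //; lra.
  nra.
have Ah : 0 <= A * h by nra.
have := sum_gain Ah f1 f2.
have : INR (\sum_i #|nb col v i U|) <= n by apply: leq_INR; rewrite -(sum_nb col vU).
have := leq_INR Dk; have -> : INR 35 = 35 by rewrite [LHS]INR_IZR_INZ.
have -> : INR 100 = 100 by rewrite [LHS]INR_IZR_INZ.
rewrite -/h -/n; move: (INR (\sum_i #|_|)) (INR (\sum_i num_tri _ _)) (INR #|nb col v k U|) (INR (num_tri col U)).
move=> s T m t dm sn hT ht.
have g1 : A * h * s <= A * h * n by apply: Rmult_le_compat_l.
have g2 : n * l <= m * h by nra.
have g3 : A * (n * l) <= A * (m * h) by apply: Rmult_le_compat_l => //; lra.
have g4 : 100000 * (n * l) <= A * (n * l) by apply: Rmult_le_compat_r => //; nra.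
nra.
Qed.

(** With [K] about [A h / 4], [num_tri_sparse] bounds the triangles of [U'] by about a quarter of
    the target, and [72 D ^ 2] is at most [288 n h]. *)
Lemma recursion_majority (R : 'I_3) (U' : {set V}) D : U' \subset U ->
  (forall i u, i != R -> u \in U' -> #|nb col u i U'| <= D)%N ->
  (num_tri col U <= num_tri col U' + 72 * (D * D))%N ->
  (2 ^ 16 * D <= #|U|)%N -> (0 < D)%N -> INR D * h <= 2 * (n * l) ->
  INR (num_tri col U) <= bound U.
Proof.
move=> sU deg le D16 D0 hD; have [l129 _ h3 hn h0] := recursion_numbers.
have [K [K1 K2]] : exists K : nat, A * h / 4 <= INR K <= A * h / 4 + 1.
  by apply: exists_nat_ceil; nra.
have Ah : 100000 <= A * h by have := growth_ge1 #|U|; rewrite -/h; nra.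
have sparse : (num_tri col U' <= #|U'| * K)%N.
  apply: (num_tri_sparse colC disj (R := R) (D := D) (L := (trunc_log 2 #|U|).+1)) => //.
  - move=> N ND; apply: INR_leq; rewrite !INR_muln.
    have [N0|N0] := posnP #|N|.
      have := num_tri_le_sqr disj N; rewrite N0 muln0 leqn0 => /eqP -> /=; lra.
    have leN : (2 ^ 16 * #|N| <= #|U|)%N.
      by apply: leq_trans D16; rewrite leq_mul2l ND orbT.
    have ltN : (#|N| < #|U|)%N.
      by apply: leq_trans leN; rewrite -[X in (X < _)%N]mul1n ltn_mul2r N0 /= -(expn0 2) ltn_exp2l.
    have := IH ltN; have := growth_shift N0 leN; rewrite -/h.
    (* A factor [2 ^ 16] in size divides [growth] by at least 64, so 16 times the bound for [N] is
       at most [|N| A h / 4]. *)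
    have : 64 <= (13 / 10) ^ 16 by lra.
    have -> : INR 16 = 16 by rewrite [LHS]INR_IZR_INZ.
    have := pos_INR #|N|; have := growth_ge1 #|N|.
    move: (INR #|N|) (growth _) (INR (num_tri _ _)) ((13 / 10) ^ 16) => x g t q g1 x0 q64 qg ht.
    have g64 : 64 * g <= h by nra.
    have : A * x * (64 * g) <= A * x * h by apply: Rmult_le_compat_l => //; nra.
    have : x * (A * h / 4) <= x * INR K by apply: Rmult_le_compat_l.
    nra.
  - by rewrite ltnS; apply/leq_trunc_log/subset_leq_card.
  - apply: INR_leq; have -> : INR 16 = 16 by rewrite [LHS]INR_IZR_INZ.
    lra.
  - apply: INR_leq; rewrite !INR_muln (S_INR (trunc_log 2 #|U|)) -/l.
    have -> : INR 16 = 16 by rewrite [LHS]INR_IZR_INZ.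
    have -> : INR 42 = 42 by rewrite [LHS]INR_IZR_INZ.
    have -> : INR 1000 = 1000 by rewrite [LHS]INR_IZR_INZ.
    (* [D h <= 2 n l] and [n l ^ 2 <= h ^ 3] give [D l <= 2 h ^ 2], small against [K * K]. *)
    have kk : (A * h / 4) * (A * h / 4) <= INR K * INR K by apply: Rmult_le_compat; lra.
    apply: Rle_trans kk; apply: (Rmult_le_reg_r h) => //.
    have s1 : INR D * h * l <= 2 * (n * l) * l by apply: Rmult_le_compat_r; lra.
    have s2 : 10000000000 * h ^ 3 <= A * A * h ^ 3.
      by apply: Rmult_le_compat_r; [apply/pow_le; lra|nra].
    nra.
have := leq_INR le; rewrite INR_addn !INR_muln.
have := leq_INR sparse; rewrite INR_muln; have := leq_INR (subset_leq_card sU).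
have -> : INR 72 = 72 by rewrite [LHS]INR_IZR_INZ.
rewrite -/n -/h; have := pos_INR #|U'|; have := pos_INR D.
move: (INR D) hD (INR #|U'|) (INR (num_tri col U')) (INR (num_tri col U)) (INR K) K1 K2.
move=> d hD m t T k K1 K2 d0 m0 mn tk hT.
have n0 : 0 < n by lra.
have e1 : m * k <= n * (A * h / 4 + 1) by apply: Rmult_le_compat; lra.
have e2 : d * d <= 4 * (n * h).
  apply: (Rmult_le_reg_r (h * h)); first nra.
  have : (d * h) * (d * h) <= (2 * (n * l)) * (2 * (n * l)).
    by apply: Rmult_le_compat => //; nra.
  have : n * (n * l ^ 2) <= n * h ^ 3 by apply: Rmult_le_compat_l => //; lra.
  nra.
have e3 : 100000 * (n * h) <= A * (n * h) by apply: Rmult_le_compat_r => //; nra.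
nra.
Qed.

(** A neighbourhood counts as large from about [n l / h] vertices on. A vertex with two large
    neighbourhoods is split, the smaller of them being [k]; if there is none, one colour
    dominates. *)
Lemma recursion_step : INR (num_tri col U) <= bound U.
Proof.
have [l129 hl h3 hn h0] := recursion_numbers.
have n0 : 0 < n by lra.
have nl : h <= n * l by nra.
have x1 : 1 <= n * l / h.
  by apply: (Rmult_le_reg_r h) => //; rewrite /Rdiv Rmult_assoc Rinv_l; lra.
have [D [D1 D2]] : exists D : nat, n * l / h <= INR D <= n * l / h + 1.
  by apply: exists_nat_ceil; lra.
have xh : n * l / h * h = n * l by field; lra.
have hD1 : n * l <= INR D * h by rewrite -{1}xh; apply: Rmult_le_compat_r; lra.
have hD2 : INR D * h <= 2 * (n * l).
  rewrite -{1}xh -Rmult_assoc; apply: Rmult_le_compat_r; lra.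
have D0 : (0 < D)%N by apply: INR_leq; rewrite /=; lra.
have D16 : (2 ^ 16 * D <= #|U|)%N.
  apply: INR_leq; rewrite INR_muln INR_expn -/n; apply: (Rmult_le_reg_r h) => //.
  have -> : INR 2 ^ 16 = 65536 by rewrite /=; lra.
  have : n * (131072 * l) <= n * h by apply: Rmult_le_compat_l; lra.
  nra.
have [|bal] := boolP [exists v, exists i, exists j, [&& v \in U, i != j,
    D <= #|nb col v i U| & D <= #|nb col v j U|]]%N.
  case/existsP=> v /existsP[i /existsP[j /and4P[vU ij Di Dj]]].
  have : (#|nb col v i U| + #|nb col v j U| <= #|U|)%N.
    rewrite -(sum_nb col vU) (bigD1 i) //= (bigD1 j) //=; last by rewrite eq_sym.
    by rewrite addnA -addnS leq_addr.
  have [le|lt] := leqP #|nb col v i U| #|nb col v j U| => sum.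
    by apply: (recursion_split vU hD1 Di); move: sum le; clear; lia.
  by apply: (recursion_split vU hD1 Dj); move: sum lt; clear; lia.
have [||R [U' [sU deg le]]] := num_tri_majority colC disj D0 (U := U).
- by apply: leq_trans D16; rewrite leq_mul2r; apply/orP; right.
- move=> v i j vU ij Di; rewrite ltnNge; apply: contra bal => Dj.
  by apply/existsP; exists v; apply/existsP; exists i; apply/existsP; exists j; apply/and4P.
exact: recursion_majority sU deg le D16 D0 hD2.
Qed.

End Recursion.

(** Up to size [A] the quadratic bound suffices. The two summands of the constant meet the two lower
    bounds on [A] in the recursion. *)
Lemma num_tri_bound : exists2 A, 0 < A & forall (V : finType) (col : V -> V -> 'I_3),
  (forall a b, col a b = col b a) ->
  (forall a b c d, rainbow3 col a b c -> rainbow3 col a b d -> c = d) ->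
  forall U : {set V}, INR (num_tri col U) <= A * INR #|U| * growth #|U|.
Proof.
have p0 : 0 < 2 ^ 129 by apply: pow_lt; lra.
exists (2 ^ 129 + 100000) => [|V col colC disj U]; first lra.
have [m] := ubnP #|U|; elim: m U => // m IH U /ltnSE leUm.
have [small|big] := Rle_or_lt (INR #|U|) (2 ^ 129 + 100000).
  have := leq_INR (num_tri_le_sqr disj U); rewrite INR_muln.
  have := growth_ge1 #|U|; have := pos_INR #|U|; move: (INR #|U|) (growth _) small => x g xA x0 g1 le.
  have : x * x <= (2 ^ 129 + 100000) * x by apply: Rmult_le_compat_r.
  have : (2 ^ 129 + 100000) * x * 1 <= (2 ^ 129 + 100000) * x * g.
    by apply: Rmult_le_compat_l => //; nra.
  lra.
apply: recursion_step => //; try lra.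
by move=> N ltN; apply: IH; exact: leq_trans leUm.
Qed.

(** * From [growth] to the exponent [sqrt 2] *)

(** [(13 / 10) ^ 5 < 4], while [sqrt 2 - 1] is at least [2 / 5]. *)
Lemma ln_13_10 : ln (13 / 10) <= (sqrt 2 - 1) * ln 2.
Proof.
have l2 : 0 < ln 2 by rewrite -ln_1; apply: ln_increasing; lra.
have s2 : 14 / 10 <= sqrt 2.
  by rewrite -(sqrt_square (14 / 10)); [apply: sqrt_le_1_alt|]; lra.
have h : INR 5 * ln (13 / 10) <= INR 2 * ln 2.
  rewrite -!ln_pow; try lra.
  by left; apply: ln_increasing; rewrite /=; lra.
by move: h; rewrite /=; nra.
Qed.

Lemma growth_Rpower n : (0 < n)%N -> INR n * growth n <= Rpower (INR n) (sqrt 2).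
Proof.
move=> n0; have n0' : 0 < INR n by apply: lt_0_INR; apply/ltP.
have -> : sqrt 2 = 1 + (sqrt 2 - 1) by lra.
rewrite Rpower_plus Rpower_1 //; apply: Rmult_le_compat_l; first lra.
rewrite /growth -Rpower_pow; last lra.
rewrite /Rpower; have exp_le x y : x <= y -> exp x <= exp y.
  by case=> [/exp_increasing|->]; lra.
apply: exp_le.
have l2 : 0 < ln 2 by rewrite -ln_1; apply: ln_increasing; lra.
have s2 : 0 <= sqrt 2 - 1.
  by have := sqrt_le_1_alt 1 2; rewrite sqrt_1; lra.
have le : INR (trunc_log 2 n) * ln 2 <= ln (INR n).
  rewrite -ln_pow; last lra.
  have le2 : 2 ^ trunc_log 2 n <= INR n.
    have -> : 2 ^ trunc_log 2 n = INR (2 ^ trunc_log 2 n)%N by rewrite INR_expn.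
    exact/leq_INR/trunc_logP.
  have p0 : 0 < 2 ^ trunc_log 2 n by apply: pow_lt; lra.
  by case: le2 => [/(ln_increasing _ _ p0)|->]; lra.
have := ln_13_10; have := pos_INR (trunc_log 2 n); nra.
Qed.

Lemma num_rainbow_bound : exists2 A, 0 < A & forall n (c : colouring n),
  (0 < n)%N -> almost_gallai3 c -> INR (num_rainbow c) <= A * Rpower (INR n) (sqrt 2).
Proof.
have [A A0 hA] := num_tri_bound; exists (32 * A) => [|n c n0 gal]; first lra.
have [mu le] := merge_colours c.
have := leq_INR le; rewrite INR_muln; have -> : INR 32 = 32 by rewrite [LHS]INR_IZR_INZ.
have := hA _ (fun x y => mu (pair_col c x y)) _ _ [set: 'I_n].
rewrite cardsT card_ord; have := growth_Rpower n0.
move: (INR (num_tri _ _)) (INR (num_rainbow c)) => t r hg ht hr.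
(* A triangle that is rainbow after merging was rainbow before, so edge-disjointness is
   inherited. *)
have : t <= A * INR n * growth n.
  apply: ht => [x y|x y z w /and3P[h1 h2 h3] /and3P[h1' h2' h3']].
    by rewrite pair_colC.
  apply: (almost_gallai3_disjoint gal (x := x) (y := y)); apply/and3P; split.
  - by apply: contraNneq h1 => ->.
  - by apply: contraNneq h2 => ->.
  - by apply: contraNneq h3 => ->.
  - by apply: contraNneq h1' => ->.
  - by apply: contraNneq h2' => ->.
  - by apply: contraNneq h3' => ->.
nra.
Qed.

(** * Bounds for [tau3] *)

Lemma num_rainbow_le_tau3 n (c : colouring n) : almost_gallai3 c ->
  (num_rainbow c <= tau3 n)%N.
Proof.
move=> gal; have lt : (num_rainbow c < (2 ^ n).+1)%N.
  rewrite ltnS; apply: leq_trans (max_card _) _.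
  by have := card_powerset [set: 'I_n]; rewrite powersetT !cardsT card_ord => ->.
apply: (leq_bigmax_cond (F := fun k : 'I_(2 ^ n).+1 => k : nat) (Ordinal lt)).
by apply/asboolP; exists c.
Qed.

Lemma tau3_le n X : 0 <= X ->
  (forall c : colouring n, almost_gallai3 c -> INR (num_rainbow c) <= X) ->
  INR (tau3 n) <= X.
Proof.
move=> X0 hX; rewrite /tau3; apply: (big_ind (fun m => INR m <= X)) => //.
- by move=> x y hx hy; rewrite /maxn; case: ifP.
- by move=> k /asboolP[c [gal <-]]; exact: hX.
Qed.

Lemma log2_lt_trunc_log n : (0 < n)%N -> log2 (INR n) < INR (trunc_log 2 n) + 1.
Proof.
move=> n0; have n0' : 0 < INR n by apply: lt_0_INR; apply/ltP.
have l2 : 0 < ln 2 by rewrite -ln_1; apply: ln_increasing; lra.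
rewrite /log2 (_ : INR 2 = 2) //; apply: (Rmult_lt_reg_r (ln 2)) => //.
rewrite /Rdiv Rmult_assoc Rinv_l ?Rmult_1_r; last lra.
rewrite -S_INR -ln_pow; last lra.
apply: ln_increasing => //.
have -> : 2 ^ (trunc_log 2 n).+1 = INR (2 ^ (trunc_log 2 n).+1)%N by rewrite INR_expn.
by apply: lt_INR; apply/ltP; exact: trunc_log_ltn.
Qed.

Lemma le_log2_pow k n : (2 ^ k <= n)%N -> INR k <= log2 (INR n).
Proof.
move=> le; have l2 : 0 < ln 2 by rewrite -ln_1; apply: ln_increasing; lra.
rewrite /log2 (_ : INR 2 = 2) //; apply: (Rmult_le_reg_r (ln 2)) => //.
rewrite /Rdiv Rmult_assoc Rinv_l ?Rmult_1_r; last lra.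
rewrite -ln_pow; last lra.
have p0 : 0 < 2 ^ k by apply: pow_lt; lra.
have := leq_INR le; rewrite INR_expn => -[/(ln_increasing _ _ p0)|->]; lra.
Qed.

Lemma three_colour_lower_bound eps : 0 < eps -> exists N : nat, forall n : nat, (N <= n)%N ->
  exists c : colouring n, almost_gallai3 c /\ uses_three_colours c /\
    (1/2 - eps) * INR n * log2 (INR n) <= INR (num_rainbow c).
Proof.
(* The cube colouring falls short of [n log n / 2] by at most [9 n / 2], so [eps log n >= 5]
   suffices. *)
move=> e0; have e5 : 0 <= 5 / eps by apply: Rlt_le; apply: Rdiv_lt_0_compat; lra.
have [k [k1 _]] := exists_nat_ceil e5.
exists (2 ^ k.+1)%N => n Nn.
have n1 : (1 < n)%N by apply: leq_trans Nn; rewrite -{1}(expn1 2) leq_exp2l.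
have [c [gal three] le] := num_rainbow_cube_log n1; exists c; split=> //; split=> //.
have := le_log2_pow Nn; have := log2_lt_trunc_log (ltnW n1); rewrite S_INR.
have := leq_INR le; rewrite INR_addn !INR_muln.
have -> : INR 8 = 8 by rewrite [LHS]INR_IZR_INZ.
have -> : INR 2 = 2 by [].
have n0 : 0 < INR n by apply: lt_0_INR; apply/ltP; exact: ltnW.
move: (INR (trunc_log 2 n)) (log2 _) (INR (num_rainbow c)) => t x r h1 h2 h3.
have ex : 5 <= eps * x.
  have : eps * (5 / eps) <= eps * x by apply: Rmult_le_compat_l; lra.
  have -> : eps * (5 / eps) = 5 by field; lra.
  by [].
have g1 : INR n * (x - 1) <= t * INR n by nra.
have g2 : INR n * 5 <= INR n * (eps * x) by apply: Rmult_le_compat_l; lra.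
nra.
Qed.

Theorem theorem1p2 :
  (* lower bound: tau_3(n) >= (1/2 - o(1)) n log n *)
  (forall eps : R, 0 < eps -> exists N : nat, forall n : nat, (N <= n)%N ->
     (1/2 - eps) * INR n * log2 (INR n) <= INR (tau3 n)) /\
  (* upper bound: tau_3(n) = O(n^sqrt2 log n) *)
  (exists C : R, 0 < C /\ exists N : nat, forall n : nat, (N <= n)%N ->
     INR (tau3 n) <= C * Rpower (INR n) (sqrt 2) * log2 (INR n)) /\
  (* the lower bound is attained by almost 3-Gallai 3-colourings *)
  (forall eps : R, 0 < eps -> exists N : nat, forall n : nat, (N <= n)%N ->
     exists c : colouring n, almost_gallai3 c /\ uses_three_colours c /\
       (1/2 - eps) * INR n * log2 (INR n) <= INR (num_rainbow c)).
Proof.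
split; [|split; last exact: three_colour_lower_bound].
- move=> eps e0; have [N hN] := three_colour_lower_bound e0; exists N => n /hN[c [gal [_ le]]].
  by apply: Rle_trans le _; apply/leq_INR/num_rainbow_le_tau3.
(* The bound obtained has no logarithm; [log2 n >= 1] from [n = 2] on inserts it. *)
- have [A A0 hA] := num_rainbow_bound; exists A; split=> //; exists 2%N => n n2.
  have log1 : 1 <= log2 (INR n) by exact: (@le_log2_pow 1).
  have p0 : 0 < Rpower (INR n) (sqrt 2) by exact: exp_pos.
  have Ap : 0 <= A * Rpower (INR n) (sqrt 2) by nra.
  apply: tau3_le => [|c gal]; first by nra.
  have := hA n c (ltnW n2) gal; nra.
Qed.
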